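(* Let $\Gamma_0=\Gamma_0[n]$ be the planar network described below. Then $$\mathrm{im}(L\Gamma_0)=\overline{\mathcal{C}_2}\cap\{t^k_0=0\ \text{for } k=0,\dots,n\},$$ where the closure is taken in $\mathbb{T}^{VT}$.
   Context: A planar network consists of a finite graph $\Gamma$, reals $a<b$, and an embedding of $\Gamma$ in the strip $\{a\le x\le b\}$ with each edge a straight segment not parallel to the $y$-axis; vertices on $x=a$ are sources, on $x=b$ sinks, others internal; edges are oriented left to right. A multipath is a subgraph each of whose vertices internal in $\Gamma$ has in- and out-degree $1$; a multipath with $k$ sources is a $k$-path; $P_k\Gamma$ is the set of $k$-paths. $\mathbb{T}=\mathbb{R}\cup\{-\infty\}$ with the topology of $[-\infty,\infty)$. A weighting is $\epsilon\in\mathbb{T}^{E\Gamma}$; $w_\alpha(\epsilon)=\sum_{e\in E\alpha}\epsilon(e)$ ($0$ if $\alpha$ has no edges). $l_i\Gamma(\epsilon)=\max_{\alpha\in P_i\Gamma}w_\alpha(\epsilon)$ for $i>0$ ($-\infty$ if no $i$-paths), $l_0\Gamma=0$. A network has rank $n$ if its sources and sinks are exactly $(a,j),(b,j)$, $j=1,\dots,n$; $\Gamma^{(k)}$ ($0\le k\le n$) is the maximal subgraph not containing $(a,j),(b,j)$ for $j>k$. $VT=\{(k,i):0\le i\le k\le n\}$ with coordinates $t^k_i$; $L\Gamma:\mathbb{T}^{E\Gamma}\to\mathbb{T}^{VT}$, $t^k_i=l_i\Gamma^{(k)}$. $\mathcal{C}_2\subset\mathbb{R}^{VT}$ is defined by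 $t^{k+1}_{i}+t^{k}_{i-1}\ge t^{k+1}_{i-1}+t^{k}_{i}$ and $t^{k+1}_{i}+t^{k}_{i}\ge t^{k+1}_{i+1}+t^{k}_{i-1}$ for $0<i\le k<n$. The network $\Gamma_0[n]$ (rank $n$): for each $j=1,\dots,n$, the horizontal line $y=j$ carries a chain of horizontal edges from $(a,j)$ to $(b,j)$ through the internal vertices on that line; in addition, for each $1\le j\le n-1$ there are $j$ slanted edges $e_{j,1},\dots,e_{j,j}$ (ordered left to right), each going from an internal vertex on line $y=j+1$ down to an internal vertex on line $y=j$. The internal vertices, read left to right, are: on line $n$, the tails of $e_{n-1,1},\dots,e_{n-1,n-1}$; on line $j$ with $2\le j\le n-1$, the head of $e_{j,1}$, the tail of $e_{j-1,1}$, the head of $e_{j,2}$, the tail of $e_{j-1,2}$, $\dots$, the tail of $e_{j-1,j-1}$, the head of $e_{j,j}$; on line $1$, the head of $e_{1,1}$. There are no other vertices or edges.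
   Formalization: Multipaths are additionally required to have no isolated vertices; otherwise a lone source would be a 1-path of weight 0 and the claim would fail already for n = 1, where it would force t^1_1 to be at least 0. *)

(* Defs.v *)
From HB Require Import structures.
From mathcomp Require Import all_boot all_order all_algebra.
From mathcomp Require Import all_classical all_reals all_analysis.
From mathcomp Require Import zify ring lra.

Set Implicit Arguments.
Unset Strict Implicit.
Unset Printing Implicit Defensive.

Import Order.TTheory GRing.Theory Num.Theory.
Import numFieldNormedType.Exports.

Local Open Scope classical_set_scope.
Local Open Scope ring_scope.

(** * Planar networks *)

Definition segment (R : realType) (p q : R * R) : set (R * R) :=
  [set z | exists2 s : R, 0 <= s <= 1 &
     z = ((1 - s) * p.1 + s * q.1, (1 - s) * p.2 + s * q.2)].

(** Since edges are straight segments of an embedded graph, there are no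
    multiple edges, so the edges form a relation on the vertices.  The
    orientation from left to right is recorded by [edge_lr], which also says
    that no edge is parallel to the y-axis. *)
Record planarNetwork (R : realType) := PlanarNetwork {
  vertex :> finType;
  edge_rel : rel vertex;
  pos : vertex -> R * R;
  xmin : R;
  xmax : R;
  xmin_lt_xmax : xmin < xmax;
  pos_strip : forall v, xmin <= (pos v).1 <= xmax;
  edge_lr : forall u v, edge_rel u v -> (pos u).1 < (pos v).1;
  pos_inj : injective pos;
  vertex_off_edge : forall u v w, edge_rel u v ->
    segment (pos u) (pos v) (pos w) -> w = u \/ w = v;
  edge_noncross : forall u v u' v', edge_rel u v -> edge_rel u' v' ->
    (u, v) <> (u', v') ->
    forall z, segment (pos u) (pos v) z -> segment (pos u') (pos v') z ->
    exists w, [/\ w = u \/ w = v, w = u' \/ w = v' & z = pos w] }.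

Section Network.
Variables (R : realType) (G : planarNetwork R).

Definition edge : finType :=
  {uv : vertex G * vertex G | edge_rel uv.1 uv.2}.
Definition edge_tail (e : edge) : G := (val e).1.
Definition edge_head (e : edge) : G := (val e).2.

Definition is_source (v : G) : bool := (pos v).1 == xmin G.
Definition is_sink (v : G) : bool := (pos v).1 == xmax G.
Definition is_internal (v : G) : bool := ~~ is_source v && ~~ is_sink v.

(** A subgraph is a set of vertices with a set of edges between them. *)
Definition pregraph := ({set G} * {set edge})%type.

Definition is_subgraph (A : pregraph) : bool :=
  [forall e in A.2, (edge_tail e \in A.1) && (edge_head e \in A.1)].

Definition indegree (A : pregraph) (v : G) : nat :=
  #|[set e in A.2 | edge_head e == v]%SET|.
Definition outdegree (A : pregraph) (v : G) : nat :=
  #|[set e in A.2 | edge_tail e == v]%SET|.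

(** Each internal vertex of a multipath has in- and out-degree 1 in it.  We also
    exclude isolated vertices, so that a lone source is not a 1-path. *)
Definition multipath (A : pregraph) : bool :=
  [&& is_subgraph A,
      [forall v in A.1, (0 < indegree A v + outdegree A v)%N] &
      [forall v in A.1, is_internal v ==>
         (indegree A v == 1%N) && (outdegree A v == 1%N)]].

Definition nsources (A : pregraph) : nat :=
  #|[set v in A.1 | is_source v]%SET|.

(** [paths H k] is the set of k-paths of the subgraph [H] of [G]. *)
Definition paths (H : pregraph) (k : nat) : {set pregraph} :=
  [set A : pregraph | [&& multipath A, A.1 \subset H.1, A.2 \subset H.2 &
                          nsources A == k]]%SET.

Definition has_rank (n : nat) : Prop :=
  (forall y : R, (exists v : G, pos v = (xmin G, y)) <->
     exists2 j : nat, (1 <= j <= n)%N & y = j%:R) /\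
  (forall y : R, (exists v : G, pos v = (xmax G, y)) <->
     exists2 j : nat, (1 <= j <= n)%N & y = j%:R).

(** The maximal subgraph of a network of rank n that contains neither
    (a, j) nor (b, j) for j > k. *)
Definition truncation (k : nat) : pregraph :=
  let V := [set v : G | ~~ ((is_source v || is_sink v) &&
                            (k%:R < (pos v).2))]%SET in
  (V, [set e : edge | (edge_tail e \in V) && (edge_head e \in V)]%SET).

End Network.

(** * Tropical numbers and the map L *)

(** [-oo, +oo) with the subspace topology: the library equips the type
    associated with a set with the topology induced by the inclusion. *)
Definition trop (R : realType) : set (\bar R) := [set x | x != +oo%E].
Arguments trop : clear implicits.

Lemma trop_fin (R : realType) (r : R) : r%:E \in trop R.
Proof. by rewrite inE. Qed.

Definition of_real (R : realType) (r : R) : trop R :=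
  exist _ r%:E (trop_fin r).

Definition VT (n : nat) : finType :=
  {p : 'I_n.+1 * 'I_n.+1 | (p.2 <= p.1)%N}.

Definition VT0 (n : nat) : VT n :=
  exist _ (ord0, ord0) (leqnn 0).

(** The element (k, i) of VT; only used for i <= k <= n. *)
Definition vt (n k i : nat) : VT n := insubd (VT0 n) (inord k, inord i).

Section MapL.
Variables (R : realType) (G : planarNetwork R).
Local Open Scope ereal_scope.
Implicit Types (eps : edge G -> trop R) (H : pregraph G).

Definition weight (A : pregraph G) eps : \bar R := \sum_(e in A.2) \val (eps e).

(** The function l_i of the subgraph [H]; the maximum over the empty set
    is -oo. *)
Definition lfun H (i : nat) eps : \bar R :=
  if i is 0 then 0 else \big[maxe/-oo]_(A in paths H i) weight A eps.

Lemma weight_trop A eps : weight A eps \in trop R.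
Proof.
rewrite /weight; elim/big_ind: _ => [|x y|e _]; first by rewrite inE.
- by rewrite !inE /trop /= => /eqP hx /eqP hy; apply/eqP; case: x y hx hy => [?||] [?||].
- exact: (valP (eps e)).
Qed.

Lemma lfun_trop H i eps : lfun H i eps \in trop R.
Proof.
case: i => [|i] /=; first by rewrite inE.
elim/big_ind: _ => [|x y hx hy|A _]; first by rewrite inE.
- by rewrite /maxe; case: ifP.
- exact: weight_trop.
Qed.

Definition Lmap (n : nat) eps : {ptws VT n -> trop R} := fun p =>
  exist (fun x => x \in trop R) _ (lfun_trop (truncation G (\val p).1) (\val p).2 eps).

End MapL.

(** * The cone C_2 *)

Definition C2 (R : realType) (n : nat) : set (VT n -> R) :=
  [set t | forall k i : nat, (0 < i)%N -> (i <= k)%N -> (k < n)%N ->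
     t (vt n k.+1 i) + t (vt n k i.-1) >= t (vt n k.+1 i.-1) + t (vt n k i) /\
     t (vt n k.+1 i) + t (vt n k i) >= t (vt n k.+1 i.+1) + t (vt n k i.-1)].

(** C_2 as a subset of T^VT. *)
Definition C2_trop (R : realType) (n : nat) : set {ptws VT n -> trop R} :=
  [set (fun p => of_real (t p)) | t in @C2 R n].

(** * The network Gamma_0[n] *)

(** The slanted edge e_{j,i}, 1 <= i <= j < n, goes from (xt j i, j+1) to
    (xh j i, j).  The abscissas are constrained only by the prescribed order of
    the vertices on each line; horizontal edges join consecutive vertices. *)
Record Gamma0_layout (R : realType) (n : nat) (G : planarNetwork R)
    (xt xh : nat -> nat -> R) : Prop := {
  layout_rank : has_rank G n;
  layout_internal : forall p : R * R,
    (exists2 v : G, is_internal v & pos v = p) <->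
    (exists j i : nat, (1 <= i <= j)%N /\ (j < n)%N /\
       (p = (xt j i, j.+1%:R) \/ p = (xh j i, j%:R)));
  layout_order_top : forall i : nat, (1 <= i)%N -> (i.+1 < n)%N ->
    xt n.-1 i < xt n.-1 i.+1;
  layout_order : forall j i : nat, (2 <= j < n)%N -> (1 <= i < j)%N ->
    xh j i < xt j.-1 i < xh j i.+1;
  layout_edge : forall u v : G, edge_rel u v <->
    (exists j i : nat, (1 <= i <= j)%N /\ (j < n)%N /\
       pos u = (xt j i, j.+1%:R) /\ pos v = (xh j i, j%:R)) \/
    [/\ (pos u).2 = (pos v).2, (pos u).1 < (pos v).1 &
        forall w : G, (pos w).2 = (pos u).2 ->
          ~ ((pos u).1 < (pos w).1 < (pos v).1)] }.

Definition is_Gamma0 (R : realType) (n : nat) (G : planarNetwork R) : Prop :=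
  exists xt xh : nat -> nat -> R, Gamma0_layout n G xt xh.

(** The layout is realizable: on line y = j the head of e_{j,i} is put at
    x = 4i + 2(n-j) and the tail of e_{j-1,i} one unit to its right. *)
Section Realization.
Variables (R : realType) (n : nat).

Definition g0_internal (x y : nat) : Prop := exists j i : nat,
  [/\ (1 <= i <= j)%N, (j < n)%N &
      (x = (4 * i + 2 * (n - j)).-1 /\ y = j.+1) \/
      (x = 4 * i + 2 * (n - j) /\ y = j)%N].

Definition g0_vertex (p : 'I_(4 * n).+2 * 'I_n.+1) : bool :=
  (1 <= p.2)%N &&
  [|| p.1 == 0 :> nat, p.1 == (4 * n).+1 :> nat | `[< g0_internal p.1 p.2 >]].

Definition g0V : finType := {p : 'I_(4 * n).+2 * 'I_n.+1 | g0_vertex p}.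
Definition g0x (v : g0V) : nat := (\val v).1.
Definition g0y (v : g0V) : nat := (\val v).2.

Definition g0_slanted (u v : g0V) : Prop :=
  exists j i : nat, [/\ (1 <= i <= j)%N, (j < n)%N,
    g0x u = (4 * i + 2 * (n - j)).-1 /\ g0y u = j.+1 &
    (g0x v = 4 * i + 2 * (n - j) /\ g0y v = j)%N].
Definition g0_horizontal (u v : g0V) : Prop :=
  [/\ g0y u = g0y v, (g0x u < g0x v)%N &
      forall w : g0V, g0y w = g0y u -> ~~ (g0x u < g0x w < g0x v)%N].
Definition g0_edge : rel g0V :=
  fun u v => `[< g0_slanted u v \/ g0_horizontal u v >].
Definition g0_pos (v : g0V) : R * R := ((g0x v)%:R, (g0y v)%:R).

Lemma g0_inj (u v : g0V) : g0x u = g0x v -> g0y u = g0y v -> u = v.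
Proof.
move=> hx hy; apply: val_inj; move: hx hy; rewrite /g0x /g0y.
by case: (\val u) (\val v) => [a b] [c d] /= /val_inj -> /val_inj ->.
Qed.

Lemma g0_pos_inj : injective g0_pos.
Proof.
move=> u v [/eqP]; rewrite eqr_nat => /eqP hx /eqP.
by rewrite eqr_nat => /eqP hy; exact: g0_inj.
Qed.

Lemma g0_slantedE (u v : g0V) : g0_slanted u v ->
  g0x v = (g0x u).+1 /\ g0y u = (g0y v).+1.
Proof. by move=> [j [i [? ? [-> ->] [-> ->]]]]; split; lia. Qed.

Lemma natr_unit (a b : nat) (s : R) : 0 <= s <= 1 -> b%:R = a%:R + s ->
  s = 0 /\ b = a \/ s = 1 /\ b = a.+1.
Proof.
move=> /andP[s0 s1] e.
have h1 : (a <= b)%N by rewrite -(ler_nat R) e; lra.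
have h2 : (b <= a.+1)%N by rewrite -(ler_nat R) e -natr1; lra.
have [h|h] : b = a \/ b = a.+1 by lia.
  by left; split => //; move: e; rewrite h; lra.
by right; split => //; move: e; rewrite h -natr1; lra.
Qed.

Lemma g0_segment_slanted (u v : g0V) z : g0_slanted u v ->
  segment (g0_pos u) (g0_pos v) z -> exists2 s : R, 0 <= s <= 1 &
    z = ((g0x u)%:R + s, (g0y v)%:R + (1 - s)).
Proof.
move=> /g0_slantedE[hx hy] [s s01 ->]; exists s => //.
rewrite /g0_pos /= hx hy -!natr1; congr (_, _); ring.
Qed.

Lemma g0_segment_horizontal (u v : g0V) z : g0_horizontal u v ->
  segment (g0_pos u) (g0_pos v) z ->
  z.2 = (g0y u)%:R /\ (g0x u)%:R <= z.1 <= (g0x v)%:R.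
Proof.
move=> [hy hx _] [s /andP[s0 s1] ->]; rewrite /g0_pos /= -hy; split; first ring.
have : (g0x u)%:R < (g0x v)%:R :> R by rewrite ltr_nat.
by move=> h; apply/andP; split; nra.
Qed.

Lemma g0_pos_strip v : (0 : R) <= (g0_pos v).1 <= (4 * n).+1%:R.
Proof. by rewrite /g0_pos /= ler0n ler_nat -ltnS ltn_ord. Qed.

Lemma g0_edge_lr u v : g0_edge u v -> (g0_pos u).1 < (g0_pos v).1.
Proof.
move=> /asboolP[/g0_slantedE[h _]|[_ h _]]; rewrite /g0_pos /= ltr_nat //.
by rewrite h.
Qed.

Lemma g0_vertex_off_edge u v w : g0_edge u v ->
  segment (g0_pos u) (g0_pos v) (g0_pos w) -> w = u \/ w = v.
Proof.
move=> /asboolP[h|h].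
  move=> /(g0_segment_slanted h)[s s01 [ex ey]].
  have [hx hy] := g0_slantedE h.
  case: (natr_unit s01 ex) => -[s_ hw]; move: ey; rewrite s_ ?subr0 ?subrr ?addr0.
    by rewrite natr1 => /eqP; rewrite eqr_nat => /eqP hy'; left; apply: g0_inj; lia.
  by move=> /eqP; rewrite eqr_nat => /eqP hy'; right; apply: g0_inj; lia.
move=> /(g0_segment_horizontal h) /= [/eqP]; rewrite eqr_nat !ler_nat.
case: h => [hy hx /(_ w)] h /eqP hw hxw; move: (h hw) => h'.
have [e|e] : g0x w = g0x u \/ g0x w = g0x v by lia.
  by left; exact: g0_inj.
by right; apply: g0_inj => //; lia.
Qed.

Lemma g0_meet u v u' v' : g0_edge u v -> g0_edge u' v' -> (u, v) <> (u', v') ->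
  forall z, segment (g0_pos u) (g0_pos v) z ->
  segment (g0_pos u') (g0_pos v') z -> exists w, z = g0_pos w.
Proof.
have SV a b z : g0_slanted a b -> segment (g0_pos a) (g0_pos b) z ->
    forall k : nat, z.2 = k%:R -> exists w, z = g0_pos w.
  move=> h hz k hk; have [hx hy] := g0_slantedE h.
  have [s s01 ez] := g0_segment_slanted h hz.
  have s01' : 0 <= 1 - s <= 1 by lra.
  have ek : k%:R = (g0y b)%:R + (1 - s) by rewrite -hk ez.
  case: (natr_unit s01' ek) => -[e hw]; [exists b | exists a]; rewrite ez /g0_pos.
    by rewrite hx -natr1 e; congr (_, _); lra.
  by rewrite hy -natr1 e; congr (_, _); lra.
move=> /asboolP[h|h] /asboolP[h'|h'] ne z hz hz'.
- have [s s01 ez] := g0_segment_slanted h hz.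
  have [s' s01' ez'] := g0_segment_slanted h' hz'.
  have [hx hy] := g0_slantedE h; have [hx' hy'] := g0_slantedE h'.
  have [ex ey] : (g0x u)%:R + s = (g0x u')%:R + s' /\
     (g0y v)%:R + (1 - s) = (g0y v')%:R + (1 - s') by move: ez; rewrite ez' => -[].
  case: (ltngtP (g0y v) (g0y v')) => hv.
  + have : (g0y v)%:R + 1 <= (g0y v')%:R :> R by rewrite natr1 ler_nat.
    move=> ?; apply: (SV _ _ _ h hz (g0y v).+1); rewrite ez /= -natr1; lra.
  + have : (g0y v')%:R + 1 <= (g0y v)%:R :> R by rewrite natr1 ler_nat.
    move=> ?; apply: (SV _ _ _ h hz (g0y v)); rewrite ez /=; lra.
  + have /eqP : (g0x u)%:R = (g0x u')%:R :> R by move: ey; rewrite hv; lra.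
    rewrite eqr_nat => /eqP hu; case: ne.
    by congr (_, _); apply: g0_inj; lia.
- have [e2 _] := g0_segment_horizontal h' hz'; exact: SV h hz _ e2.
- have [e2 _] := g0_segment_horizontal h hz; exact: SV h' hz' _ e2.
have [e2 r] := g0_segment_horizontal h hz.
have [e2' r'] := g0_segment_horizontal h' hz'.
have /eqP : (g0y u)%:R = (g0y u')%:R :> R by rewrite -e2.
rewrite eqr_nat => /eqP hy.
case: h => hyv hx hb; case: h' => hyv' hx' hb'.
have := hb u' (esym hy); have := hb' u hy.
have := hb v' ltac:(lia); have := hb' v ltac:(lia) => b1 b2 b3 b4.
case: (ltngtP (g0x u) (g0x u')) => hu.
- have le : (g0x v)%:R <= (g0x u')%:R :> R by rewrite ler_nat; lia.
  exists v; rewrite /g0_pos (surjective_pairing z) e2 hyv; congr (_, _); lra.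
- have le : (g0x v')%:R <= (g0x u)%:R :> R by rewrite ler_nat; lia.
  exists u; rewrite /g0_pos (surjective_pairing z) e2; congr (_, _); lra.
- by case: ne; congr (_, _); apply: g0_inj; lia.
Qed.

Lemma g0_edge_noncross u v u' v' : g0_edge u v -> g0_edge u' v' ->
  (u, v) <> (u', v') ->
  forall z, segment (g0_pos u) (g0_pos v) z ->
  segment (g0_pos u') (g0_pos v') z ->
  exists w, [/\ w = u \/ w = v, w = u' \/ w = v' & z = g0_pos w].
Proof.
move=> h h' ne z hz hz'; have [w zw] := g0_meet h h' ne hz hz'; exists w.
move: hz hz'; rewrite zw => hz hz'.
by split => //; [exact: g0_vertex_off_edge hz|exact: g0_vertex_off_edge hz'].
Qed.

Definition Gamma0 : planarNetwork R :=
  @PlanarNetwork R g0V g0_edge g0_pos 0 (4 * n).+1%:R (ltr0Sn _ _) g0_pos_strip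
    g0_edge_lr g0_pos_inj g0_vertex_off_edge g0_edge_noncross.

Lemma g0_mk (x y : nat) : (1 <= y <= n)%N ->
  [\/ x = 0%N, x = (4 * n).+1 | g0_internal x y] ->
  exists v : g0V, g0x v = x /\ g0y v = y.
Proof.
move=> hy hx.
have lx : (x < (4 * n).+2)%N.
  by case: hx => [->|->|[j [i [? ? h]]]] //; lia.
have ly : (y < n.+1)%N by lia.
have hv : g0_vertex (Ordinal lx, Ordinal ly).
  rewrite /g0_vertex /=; apply/andP; split; first by lia.
  case: hx => [->|->|h]; rewrite ?eqxx ?orbT //.
  by apply/orP; right; apply/orP; right; apply/asboolP.
by exists (exist (fun p => is_true (g0_vertex p)) _ hv).
Qed.

Lemma g0_yP (v : g0V) : (1 <= g0y v <= n)%N.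
Proof.
by have /andP[h _] := valP v; rewrite h -ltnS ltn_ord.
Qed.

Lemma Gamma0P : is_Gamma0 n Gamma0.
Proof.
exists (fun j i => (4 * i + 2 * (n - j)).-1%:R).
exists (fun j i => (4 * i + 2 * (n - j))%:R).
have rk x : x = 0%N \/ x = (4 * n).+1 -> forall y : R,
    (exists v : Gamma0, pos v = (x%:R, y)) <->
    (exists2 j : nat, (1 <= j <= n)%N & y = j%:R).
  move=> hx y; split => [[v [_ <-]]|[j hj ->]].
    by exists (g0y v) => //; exact: g0_yP.
  have [|v [ex ey]] := @g0_mk x j hj; first by case: hx => ?; [apply: Or31|apply: Or32].
  by exists v; rewrite /pos /= /g0_pos ex ey.
split.
- split; [exact: (rk 0%N (or_introl erefl))|exact: (rk _ (or_intror erefl))].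
- move=> p; split.
    move=> [v]; rewrite /is_internal /is_source /is_sink /= pnatr_eq0 eqr_nat => /andP[s t] <-.
    have /andP[_] := valP v; rewrite -/(g0x v) (negPf s) (negPf t) /=.
    move=> /asboolP[j [i [h1 h2 h3]]]; exists j, i; do 2!split => //.
    have {}h3 : (g0x v = (4 * i + 2 * (n - j)).-1 /\ g0y v = j.+1) \/
      (g0x v = 4 * i + 2 * (n - j) /\ g0y v = j)%N by [].
    by rewrite /g0_pos; case: h3 => -[-> ->]; [left|right].
  move=> [j [i [h1 [h2 h3]]]].
  have [x [y [hy hx ep]]] : exists x y : nat, [/\ (1 <= y <= n)%N,
      g0_internal x y & p = (x%:R, y%:R)].
    case: h3 => ->.
      exists (4 * i + 2 * (n - j)).-1, j.+1; split => //.
      by exists j, i; split => //; left.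
    exists (4 * i + 2 * (n - j))%N, j; split => //; first by lia.
    by exists j, i; split => //; right.
  have [|v [ex ey]] := @g0_mk x y hy; first by apply: Or33.
  exists v; last by rewrite /pos /= /g0_pos ex ey ep.
  case: hx => k [l [? ? h]].
  by rewrite /is_internal /is_source /is_sink /= pnatr_eq0 eqr_nat ex; lia.
- by move=> i ? ?; rewrite ltr_nat; lia.
- by move=> j i ? ?; rewrite !ltr_nat; lia.
move=> u v; split.
  move=> /asboolP[[j [i [h1 h2 [a b] [c d]]]]|[hy hx h]].
    left; exists j, i; do 3!split => //; first by rewrite /= /g0_pos a b.
    by rewrite /= /g0_pos c d.
  right; split; rewrite /= ?hy ?ltr_nat // => w /eqP.
  rewrite eqr_nat !ltr_nat => /eqP hw; have := h w; rewrite hy => /(_ hw).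
  by move=> /negP.
move=> hh; apply/asboolP; case: hh => [[j [i [h1 [h2 [[/eqP a /eqP b] [/eqP c /eqP d]]]]]]|].
  left; exists j, i; move: a b c d.
  by rewrite !eqr_nat => /eqP a /eqP b /eqP c /eqP d.
move=> [/eqP]; rewrite /= eqr_nat ltr_nat => /eqP hy hx h; right; split => // w hw.
apply/negP => /andP[? ?]; apply: (h w); first by rewrite hw.
by rewrite !ltr_nat; apply/andP.
Qed.

End Realization.

(* Main.v *)
Require Import Defs.
From HB Require Import structures.
From mathcomp Require Import all_boot all_order all_algebra.
From mathcomp Require Import all_classical all_reals all_analysis.
From mathcomp Require Import zify ring lra.

Set Implicit Arguments.
Unset Strict Implicit.
Unset Printing Implicit Defensive.

Import Order.TTheory GRing.Theory Num.Theory.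
Import numFieldNormedType.Exports.

Local Open Scope classical_set_scope.
Local Open Scope ring_scope.

(** A multipath in Gamma0 is a 0/1 flow, hence the jump across edges of a height
    function H on the faces: H counts the paths passing below a face.  The face of
    the strip between the lines y = j and y = j+1 just to the right of e_{j,i} is
    numbered (j, i); (j, 0) is the leftmost one.

    In terms of lambda^k_i = t^k_i - t^k_{i-1} the cone C_2 consists of the
    Gelfand-Tsetlin patterns.  For real weights L lands in C_2: rounding half of
    the sum of two height functions up and down redistributes the edges of two
    multipaths and gives the rhombus inequalities.  Conversely a pattern is
    realized by giving the first edge of line j the weight lambda^j_1, the edge
    leaving the tail of e_{j,i} along line j+1 the weight
    lambda^{j+1}_{i+1} - lambda^j_i <= 0, and all other edges the weight 0.
    These weights are bounded above in terms of t, so that compactness of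
    [-oo, M] and continuity of L settle the points of the closure. *)

(** * Topology of tropical space *)

Lemma eq_continuous (X Y : topologicalType) (f g : X -> Y) :
  f =1 g -> continuous f -> continuous g.
Proof. by move=> /funext ->. Qed.

Section TropTopology.
Variable R : realType.
Implicit Type M : R.

Lemma trop_add (x y : \bar R) :
  x \in trop R -> y \in trop R -> (x + y)%E \in trop R.
Proof. by rewrite !inE /trop /=; case: x y => [?||] [?||]. Qed.

Lemma trop_hausdorff : hausdorff_space (trop R).
Proof.
move=> x y clxy; apply: val_inj; apply: ereal_hausdorff => A B nA nB.
have cv := @initial_continuous _ _ (set_val : trop R -> \bar R).
have [z [Az Bz]] := clxy _ _ (cv x A nA) (cv y B nB).
by exists (\val z); split.
Qed.


(** The topology is the product of those induced by inclusion into [\bar R], so continuity can be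
    tested on extended real coordinates. *)
Lemma trop_ptws_continuous (X : topologicalType) (I : choiceType)
    (f : X -> {ptws I -> trop R}) :
  (forall i, continuous (fun x => \val (f x i))) -> continuous f.
Proof.
move=> cf x; apply/cvg_sup => i.
have cfi : continuous ((fun g : I -> trop R => g i) \o f : X -> trop R).
  by apply: continuous_comp_initial; exact: cf.
have := @continuous_comp_initial (I -> trop R) X (trop R) (fun g => g i) f.
by apply.
Qed.

Lemma trop_proj_continuous (I : choiceType) (i : I) :
  continuous (fun f : {ptws I -> trop R} => \val (f i)).
Proof.
move=> f.
apply: (@continuous_comp _ _ _ (fun f : {ptws I -> trop R} => f i) set_val).
  by apply: (@proj_continuous I (fun _ => trop R)).
exact: initial_continuous.
Qed.

Lemma trop_adde_def (x y : \bar R) :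
  x \in trop R -> y \in trop R -> (x +? y)%E.
Proof. by rewrite !inE /trop /=; case: x y => [?||] [?||]. Qed.

(** Addition on [\bar R] fails to be continuous only where opposite infinities meet, and [trop R]
    omits [+oo]. *)
Lemma trop_add_continuous (X : topologicalType) (f g : X -> \bar R) :
  (forall x, f x \in trop R) -> (forall x, g x \in trop R) ->
  continuous f -> continuous g -> continuous (fun x => f x + g x)%E.
Proof.
move=> hf hg cf cg x; apply: cvgeD; [|exact: cf|exact: cg].
exact: trop_adde_def.
Qed.

Lemma contract_expand (r : R) :
  contract (expand r) = if r < -1 then -1 else if 1 < r then 1 else r.
Proof.
case: ltP => [h|h]; first by rewrite expandN1 //; exact: ltW.
case: ltP => [h'|h']; first by rewrite expand1 //; exact: ltW.
by rewrite expandK // inE ler_norml h.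
Qed.

(** Balls of [\bar R] are measured through [contract], and [contract] after [expand] clamps to
    [-1, 1], which does not increase distances. *)
Lemma expand_continuous : continuous (@expand R).
Proof.
move=> r; apply/cvg_ballP => e e0; near=> s.
have : `|r - s| < e by near: s; apply/nbhs_ballP; exists e.
rewrite /ball /= /ereal_ball !contract_expand !ltr_distl => /andP[? ?].
apply/andP.
by case: (ltP r) => ?; case: (ltP 1 r) => ?; case: (ltP s) => ?;
  case: (ltP 1 s) => ?; split; lra.
Unshelve. all: by end_near. Qed.

Lemma ereal_compact : compact [set: \bar R].
Proof.
have -> : [set: \bar R] = @expand R @` `[-1, 1]%classic.
  apply/seteqP; split => // x _; exists (contract x); last exact: contractK.
  by rewrite /= in_itv /= -ler_norml; exact: contract_le1.
apply: continuous_compact; last exact: segment_compact.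
by apply: continuous_subspaceT; exact: expand_continuous.
Qed.

(** By Tychonoff it suffices to treat [-oo, M], the image of the compact space [\bar R] under
    truncation at [M]. *)
Lemma bounded_trop_compact (I : choiceType) M :
  compact [set f : {ptws I -> trop R} | forall i, (\val (f i) <= M%:E)%E].
Proof.
apply: (@tychonoff I (fun _ => trop R) (fun _ => [set x | (\val x <= M%:E)%E])) => _.
have tM x : Order.min x M%:E \in trop R.
  by rewrite inE /trop /= lt_eqF // gt_min ltry orbT.
pose g x : trop R := 
  exist (fun y : \bar R => y \in trop R) _ (tM x).
have -> : [set x : trop R | (\val x <= M%:E)%E] = g @` setT.
  apply/seteqP; split => [x xM|_ [x _ <-]] /=; last by rewrite ge_min lexx orbT.
  by exists (\val x) => //; apply: val_inj; rewrite /= min_l.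
apply: continuous_compact; last exact: ereal_compact.
apply: continuous_subspaceT; apply: continuous_comp_initial.
apply: (min_fun_continuous (f := fun x : \bar R => x) (g := fun=> M%:E)).
  by move=> ?; exact: cvg_id.
by move=> ?; exact: cvg_cst.
Qed.
End TropTopology.


(** * Continuity of L and density of the real weights *)

Section LmapTopology.
Variables (R : realType) (G : planarNetwork R).
Implicit Types (A H : pregraph G).

Lemma weight_continuous A :
  continuous (fun eps : {ptws edge G -> trop R} => weight A eps).
Proof.
rewrite /weight; elim: (index_enum _) => [|e s IHs].
  apply: (eq_continuous (f := cst 0%E)) => [?|]; first by rewrite big_nil.
  exact: cst_continuous.
have sT (x : {ptws edge G -> trop R}) :
    (\sum_(e <- s | e \in A.2) \val (x e))%E \in trop R.
  elim/big_ind: _ => [|y z|i _]; [by rewrite inE|exact: trop_add|exact: valP].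
pose f (x : {ptws edge G -> trop R}) := (if e \in A.2 then
    \val (x e) + \sum_(e <- s | e \in A.2) \val (x e) else
    \sum_(e <- s | e \in A.2) \val (x e))%E.
apply: (eq_continuous (f := f)); first by move=> x; rewrite big_cons.
rewrite /f; case: (e \in A.2) => //.
apply: trop_add_continuous => // [x|]; first exact: valP.
exact: trop_proj_continuous.
Qed.

Lemma lfun_continuous H i :
  continuous (fun eps : {ptws edge G -> trop R} => lfun H i eps).
Proof.
case: i => [|i] /=; first exact: cst_continuous.
elim: (index_enum _) => [|A s IHs].
  apply: (eq_continuous (f := cst -oo%E)) => [?|]; first by rewrite big_nil.
  exact: cst_continuous.
pose f (x : {ptws edge G -> trop R}) := (if A \in paths H i.+1 then
    Order.max (weight A x) (\big[maxe/-oo]_(A <- s | A \in paths H i.+1) weight A x)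
    else \big[maxe/-oo]_(A <- s | A \in paths H i.+1) weight A x)%E.
apply: (eq_continuous (f := f)); first by move=> x; rewrite big_cons.
rewrite /f; case: (A \in paths H i.+1) => //.
apply: max_fun_continuous => //; exact: weight_continuous.
Qed.

Lemma Lmap_continuous n :
  continuous (@Lmap R G n : {ptws edge G -> trop R} -> {ptws VT n -> trop R}).
Proof. by apply: trop_ptws_continuous => p /=; exact: lfun_continuous. Qed.

Lemma closure_ptws_real (I : choiceType) (eps : {ptws I -> trop R}) :
  closure (range (fun (w : I -> R) => (fun i => of_real (w i)) : {ptws I -> trop R}))
    eps.
Proof.
(* Raising every coordinate to at least -N gives real points, eventually constant at real
   coordinates and tending to -oo at the others. *)
pose u (N : nat) : {ptws I -> trop R} :=
  fun i => of_real (fine (Order.max (\val (eps i)) (- N%:R)%:E)).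
have cu : u @ \oo --> eps.
  apply/cvg_sup => i.
  have cui : (fun N => u N i) @ \oo --> eps i.
    suff cv : (fun N => \val (u N i)) @ \oo --> \val (eps i).
      move=> U [?/= [[W oW <-]]] /= Wsfz /filterS; apply; apply: cv.
      exact: open_nbhs_nbhs.
    rewrite /u /=; case: (eps i) => [[r||] //= hr].
    - apply: cvg_near_cst; near=> N.
      rewrite max_l // lee_fin lerNl.
      by near: N; exact: nbhs_infty_ger.
    - by move: hr; rewrite inE /trop /=.
    - apply/cvgeNyPle => A; near=> N.
      rewrite max_r ?leNye // lee_fin lerNl.
      by near: N; exact: nbhs_infty_ger.
  move=> U [?/= [[W oW <-]]] /= Wsfz /filterS; apply; apply: cui.
  exact: open_nbhs_nbhs.
move=> B /cu [N _ /(_ N (leqnn N)) BN].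
exists (u N); split => //.
Unshelve. all: by end_near. Qed.

Lemma closure_image (X Y : topologicalType) (f : X -> Y) (A : set X) :
  continuous f -> f @` closure A `<=` closure (f @` A).
Proof.
move=> cf _ [x clx <-] B nB.
have [y [Ay By]] := clx _ (cf x _ nB).
by exists (f y); split => //; exists y.
Qed.

End LmapTopology.

(** * Labels of vertices and edges, and height functions *)

(* Hd j i and Tl j i are the head and the tail of the slanted edge e_{j,i}. *)
Inductive vlabel := Src of nat | Snk of nat | Hd of nat & nat | Tl of nat & nat.

(* A horizontal edge is labelled by the vertex where it starts. *)
Inductive elabel := Hor of vlabel | Slant of nat & nat.

HB.instance Definition _ := gen_eqMixin vlabel.
HB.instance Definition _ := gen_eqMixin elabel.

Definition slot (n j i : nat) : bool := [&& 0 < i, i <= j & j < n]%N.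

Definition valid_vlabel (n : nat) (l : vlabel) : bool :=
  match l with
  | Src j | Snk j => (0 < j <= n)%N
  | Hd j i | Tl j i => slot n j i
  end.

Definition internal_vlabel (l : vlabel) : bool :=
  match l with Src _ | Snk _ => false | Hd _ _ | Tl _ _ => true end.

Definition valid_elabel (n : nat) (c : elabel) : bool :=
  match c with
  | Hor (Src j) => (0 < j <= n)%N
  | Hor (Snk _) => false
  | Hor (Hd j i) | Hor (Tl j i) | Slant j i => slot n j i
  end.

(** The right neighbour on the same line. Heads and tails alternate on an inner line; the top line
    carries tails only and, for n = 1, no internal vertex. The value at a sink is a default. *)
Definition next_vlabel (n : nat) (l : vlabel) : vlabel :=
  match l with
  | Src j => if (j < n)%N then Hd j 1 else if n == 1%N then Snk j else Tl j.-1 1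
  | Hd j i => if (i < j)%N then Tl j.-1 i else Snk j
  | Tl j i => if (j.+1 < n)%N then Hd j.+1 i.+1
              else if (i < j)%N then Tl j i.+1 else Snk j.+1
  | Snk j => Snk j
  end.

Definition elabel_tail (c : elabel) : vlabel :=
  match c with Hor l => l | Slant j i => Tl j i end.

Definition elabel_head (n : nat) (c : elabel) : vlabel :=
  match c with Hor l => next_vlabel n l | Slant j i => Hd j i end.

Definition in_elabels (n : nat) (l : vlabel) : seq elabel :=
  match l with
  | Src _ => [::]
  | Hd j i => [:: Slant j i; if i == 1%N then Hor (Src j) else Hor (Tl j.-1 i.-1)]
  | Tl j i => [:: if (j.+1 < n)%N then Hor (Hd j.+1 i)
                  else if i == 1%N then Hor (Src n) else Hor (Tl j i.-1)]
  | Snk j => [:: if (j < n)%N then Hor (Hd j j)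
                 else if n == 1%N then Hor (Src 1) else Hor (Tl j.-1 j.-1)]
  end.

Definition out_elabels (l : vlabel) : seq elabel :=
  match l with
  | Src _ | Hd _ _ => [:: Hor l]
  | Tl j i => [:: Hor l; Slant j i]
  | Snk _ => [::]
  end.

Lemma in_elabelsP n l c : valid_vlabel n l -> valid_elabel n c ->
  (elabel_head n c == l) = (c \in in_elabels n l).
Proof.
move=> vl vc; apply/eqP/idP => [<-|].
  case: c vc {vl} => [[j|//|j i|j i]|j i]; rewrite /= ?/slot => vc.
  - case: ifPn => h /=; first by rewrite !inE eqxx orbT.
    case: ifPn => h' /=; rewrite inE ?h' ?(negPf h) ?eqxx /=.
      by apply/eqP; congr (Hor (Src _)); lia.
    rewrite (_ : j.-1.+1 < n = false)%N; last by lia.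
    by apply/eqP; congr (Hor (Src _)); lia.
  - case: ifPn => h /=; rewrite inE.
      rewrite (_ : j.-1.+1 < n)%N; last by lia.
      by rewrite prednK ?eqxx //; lia.
    by rewrite (_ : j < n)%N; [apply/eqP; congr (Hor (Hd _ _)); lia|lia].
  - case: ifPn => h /=; first by rewrite !inE -[_ == 1%N]/(i == 0%N) gtn_eqF ?eqxx ?orbT //; lia.
    case: ifPn => h' /=; rewrite inE (negPf h).
      by rewrite (_ : (i.+1 == 1%N) = false) ?eqxx //; lia.
    rewrite (_ : (n == 1%N) = false); last by lia.
    by apply/eqP; congr (Hor (Tl _ _)); lia.
  - by rewrite inE eqxx.
case: l vl => [j|j|j i|j i] //=; rewrite ?mem_seq1 ?mem_seq2 /slot => vl.
- move=> /eqP ?; subst c; move: vc => /=.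
  do 6?[case: ifPn => /= ?]; rewrite ?/slot => vc; first [lia | congr Snk; lia].
- move=> /orP[|] /eqP ?; subst c; move: vc => //=.
  do 6?[case: ifPn => /= ?]; rewrite ?/slot => vc; first [lia | congr Hd; lia].
- move=> /eqP ?; subst c; move: vc => /=.
  do 6?[case: ifPn => /= ?]; rewrite ?/slot => vc; first [lia | congr Tl; lia].
Qed.

Lemma out_elabelsP n l c : valid_elabel n c ->
  (elabel_tail c == l) = (c \in out_elabels l).
Proof.
move=> vc; apply/eqP/idP => [<-|].
  by case: c vc => [[j|//|j i|j i]|j i] _;
    rewrite /= ?mem_seq1 ?mem_seq2 eqxx ?orbT.
by case: l => [j|j|j i|j i] //=; rewrite ?mem_seq1 ?mem_seq2;
  [move/eqP->|move/eqP->|case/orP => /eqP->].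
Qed.

Lemma in_elabels_valid n l : valid_vlabel n l -> all (valid_elabel n) (in_elabels n l).
Proof.
case: l => [j|j|j i|j i] //=; rewrite /slot => h; rewrite ?andbT.
- by do 2?[case: ifPn => /= ?]; rewrite /slot; lia.
- by rewrite h; case: ifPn => /= ?; rewrite /slot; lia.
- by do 2?[case: ifPn => /= ?]; rewrite /slot; lia.
Qed.

Lemma in_elabels_uniq n l : uniq (in_elabels n l).
Proof.
by case: l => [j|j|j i|j i] //=; rewrite mem_seq1 andbT; case: ifP => _; apply/eqP.
Qed.

Lemma out_elabels_uniq l : uniq (out_elabels l).
Proof. by case: l => [j|j|j i|j i] //=; rewrite mem_seq1 andbT; apply/eqP. Qed.

Lemma out_elabels_valid n l : valid_vlabel n l -> all (valid_elabel n) (out_elabels l).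
Proof. by case: l => [j|j|j i|j i] //= h; rewrite h. Qed.

Lemma elabel_inj n c c' : valid_elabel n c -> valid_elabel n c' ->
  elabel_tail c = elabel_tail c' -> elabel_head n c = elabel_head n c' -> c = c'.
Proof.
case: c => [l|j i]; case: c' => [l'|j' i'] //= v v'; first by move=> ->.
- move=> e; subst l; move: v => /=; do 2?[case: ifPn => ? //=]; rewrite /slot => ? [? ?]; lia.
- move=> e; subst l'; move: v' => /=; do 2?[case: ifPn => // ?]; rewrite /slot => ? [? ?]; lia.
- by move=> [-> ->].
Qed.

Lemma elabel_tail_valid n c : valid_elabel n c -> valid_vlabel n (elabel_tail c).
Proof. by case: c => [[]|]. Qed.

Lemma elabel_head_valid n c : valid_elabel n c -> valid_vlabel n (elabel_head n c).
Proof.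
case: c => [[j|//|j i|j i]|j i] //=; rewrite /slot => v;
  by do 2?[case: ifPn => /= ?]; rewrite /slot; lia.
Qed.

(** * Height functions: conservation, standard heights and rounding *)

Section Heights.
Local Open Scope nat_scope.
Implicit Types (n k r : nat) (H : nat -> nat -> nat).

(* The heights of the two faces adjacent to an edge.  On the top line y = n all
   (n, i) denote the unbounded face; Hor (Snk _) labels no edge. *)
Definition upper H (c : elabel) : nat :=
  match c with
  | Hor (Src j) => H j 0 | Hor (Snk _) => 0
  | Hor (Hd j i) => H j i
  | Hor (Tl j i) => H j.+1 i
  | Slant j i => H j i
  end.

Definition lower H (c : elabel) : nat :=
  match c with
  | Hor (Src j) => H j.-1 0 | Hor (Snk _) => 0
  | Hor (Hd j i) => H j.-1 i.-1
  | Hor (Tl j i) => H j i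
  | Slant j i => H j i.-1
  end.

(* The height functions of the r-paths of Gamma^(k): nothing changes above line k. *)
Definition height n k r H : Prop :=
  [/\ H 0 0 = 0,
      forall j i, (k <= j <= n)%N -> (i <= j)%N -> H j i = r &
      forall c, valid_elabel n c -> (lower H c <= upper H c <= (lower H c).+1)%N].

(** Crossing horizontal edges upwards never lowers the height, which is [r] at the top. *)
Lemma height_le n k r H j i : (k <= n)%N -> height n k r H ->
  (i <= j <= n)%N -> (H j i <= r)%N.
Proof.
move=> kn [_ hr hc] hij; move: {2}(n - j)%N (leqnn (n - j)) => d.
elim: d j i hij => [|d IHd] j i hij hd; first by rewrite hr //; lia.
have [jn|jn] := leqP n j; first by rewrite hr //; lia.
apply: leq_trans (IHd j.+1 i _ _); [|lia|lia].
case: i hij hd => [|i] hij hd.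
  by have /andP[] := hc (Hor (Src j.+1)) ltac:(rewrite /=; lia).
by have /andP[] := hc (Hor (Tl j i.+1)) ltac:(rewrite /= /slot; lia).
Qed.

Lemma upper_le n k r H c : (k <= n)%N -> height n k r H -> valid_elabel n c ->
  (upper H c <= r)%N.
Proof.
by move=> kn hH; case: c => [[j|//|j i|j i]|j i] /=; rewrite ?/slot => h;
   apply: (height_le kn hH); lia.
Qed.

Definition flow H (c : elabel) : nat := (upper H c != lower H c).

Lemma flowE n k r H c : height n k r H -> valid_elabel n c ->
  upper H c = (lower H c + flow H c)%N.
Proof. by move=> [_ _ h] /h; rewrite /flow; case: eqP => /=; lia. Qed.

Lemma height_conservation n k r H l : height n k r H -> (k <= n)%N ->
  valid_vlabel n l -> internal_vlabel l ->
  (\sum_(c <- in_elabels n l) flow H c = \sum_(c <- out_elabels l) flow H c)%N.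
Proof.
move=> hH kn vl il.
(* A tail on the top line borders the unbounded face under two indices, which must carry the same
   height. *)
have hn i j : (i <= n)%N -> (j <= n)%N -> H n i = H n j.
  by move=> ? ?; have [_ hr _] := hH; rewrite !hr //; lia.
have := in_elabels_valid vl; have := out_elabels_valid vl.
case: l vl il => // j i; rewrite /= /slot !big_cons big_nil.
  move=> vl _; rewrite !andbT => v1 /andP[v2 v3].
  have := @flowE _ _ _ _ (Slant j i) hH v2; have := flowE hH v3.
  have := @flowE _ _ _ _ (Hor (Hd j i)) hH v1.
  case: ifPn v3 => i1 _ /=; last by rewrite prednK //; lia.
  by rewrite (eqP i1) /=; lia.
move=> vl _; rewrite !andbT => /andP[v1 v2] v3.
have := flowE hH v3.
have := @flowE _ _ _ _ (Hor (Tl j i)) hH v1.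
have := @flowE _ _ _ _ (Slant j i) hH v2.
case: ifPn v3 => [jn|jn] _ /=; first by lia.
have -> : n = j.+1 by lia.
have e : j.+1 = n by lia.
have := hn i 0%N; have := hn i i.-1; rewrite -e.
case: ifPn => i1 /=; last by lia.
by rewrite (eqP i1) /=; lia.
Qed.

(** For r <= k, the m-th lowest path runs from source k - r + m to sink m and descends through the
    edges e_{j,m}. This multipath will be optimal for pattern weights. *)
Definition standard_height k r : nat -> nat -> nat :=
  fun j i => minn r (maxn i (j - (k - r))).

Lemma standard_heightP n k r : (r <= k <= n)%N -> height n k r (standard_height k r).
Proof.
rewrite /standard_height => h; split => [|j i hj hi|]; [lia|lia|].
by case=> [[j|//|j i|j i]|j i] /=; rewrite ?/slot; lia.
Qed.

(* The i-th lowest path of the superposition of two multipaths passes below the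
   faces of height at least i: rounding half of the total height up or down keeps
   the paths of odd or even rank. *)
Lemma height_split n k p q Ha Hb : (k < n)%N ->
  height n k.+1 p Ha -> height n k q Hb ->
  let H j i := (Ha j i + Hb j i)%N in
  let H1 j i := uphalf (H j i) in let H2 j i := (H j i)./2 in
  if odd (p + q) then
    height n k.+1 (uphalf (p + q)) H1 /\ height n k (p + q)./2 H2
  else height n k.+1 (p + q)./2 H2 /\ height n k (uphalf (p + q)) H1.
Proof.
move=> kn hHa hHb H H1 H2.
have [a0 ak ac] := hHa; have [b0 bk bc] := hHb.
(* On line k + 1 the height [Ha] is [p], so on line [k] it is p or p - 1; the rounding absorbs this
   difference. *)
have Hk i : (i <= k)%N -> (p <= (Ha k i).+1)%N /\ (Ha k i <= p)%N.
  move=> ik; split; last by apply: (height_le _ hHa) => //; lia.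
  case: i ik => [|i] ik.
    have := ac (Hor (Src k.+1)); rewrite /= (ak k.+1); lia.
  by have := ac (Hor (Tl k i.+1)); rewrite /= /slot (ak k.+1); lia.
have c1 c : valid_elabel n c ->
    (lower H1 c <= upper H1 c <= (lower H1 c).+1)%N.
  by move=> v; have := ac c v; have := bc c v; rewrite /H1 /H;
    case: c v => [[j|//|j i|j i]|j i] /=; lia.
have c2 c : valid_elabel n c ->
    (lower H2 c <= upper H2 c <= (lower H2 c).+1)%N.
  by move=> v; have := ac c v; have := bc c v; rewrite /H2 /H;
    case: c v => [[j|//|j i|j i]|j i] /=; lia.
have H10 : H1 0 0 = 0 by rewrite /H1 /H a0 b0.
have H20 : H2 0 0 = 0 by rewrite /H2 /H a0 b0.
case: ifPn => opq; split; split => // j i hj hi; rewrite /H1 /H2 /H.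
- by rewrite ak // ?bk //; lia.
- rewrite bk //; have [jk|jk] := ltnP k j; first by rewrite ak //; lia.
  have -> : j = k by lia.
  by have := Hk i; lia.
- by rewrite ak // ?bk //; lia.
- rewrite bk //; have [jk|jk] := ltnP k j; first by rewrite ak //; lia.
  have -> : j = k by lia.
  by have := Hk i; lia.
Qed.

(** [uphalf] and [half] of a number add up to it, so the rounded heights together jump across each
    edge as much as the original two. *)
Lemma flow_split Ha Hb c :
  (lower Ha c <= upper Ha c)%N -> (lower Hb c <= upper Hb c)%N ->
  let H j i := (Ha j i + Hb j i)%N in
  let H1 j i := uphalf (H j i) in let H2 j i := (H j i)./2 in
  (upper H1 c - lower H1 c + (upper H2 c - lower H2 c) =
   upper Ha c - lower Ha c + (upper Hb c - lower Hb c))%N.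
Proof. by case: c => [[j|//|j i|j i]|j i] /=; lia. Qed.

End Heights.

(** * Weights realizing a Gelfand-Tsetlin pattern *)

Definition slots (n : nat) : seq (nat * nat) :=
  [seq (j, i.+1) | j <- iota 0 n, i <- iota 0 j].

Definition elabels (n : nat) : seq elabel :=
  [seq Hor (Src j.+1) | j <- iota 0 n] ++
  [seq Hor (Hd p.1 p.2) | p <- slots n] ++
  [seq Hor (Tl p.1 p.2) | p <- slots n] ++
  [seq Slant p.1 p.2 | p <- slots n].

Lemma mem_slots n j i : ((j, i) \in slots n) = slot n j i.
Proof.
apply/allpairsPdep/idP => [[j' [i' []]]|].
  by rewrite !mem_iota /slot => hj hi [-> ->]; lia.
by case: i => [|i]; rewrite /slot // => h; exists j, i; split => //; rewrite mem_iota; lia.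
Qed.

Lemma slots_uniq n : uniq (slots n).
Proof.
apply: allpairs_uniq_dep => [|j _|[j i] [j' i'] _ _ /= [-> ->]] //.
- exact: iota_uniq.
- exact: iota_uniq.
Qed.

Lemma mem_elabels n c : (c \in elabels n) = valid_elabel n c.
Proof.
rewrite !mem_cat; apply/idP/idP.
  case/or4P => /mapP[].
  - by move=> j; rewrite mem_iota => h -> /=; lia.
  - by move=> [j i]; rewrite mem_slots => h ->.
  - by move=> [j i]; rewrite mem_slots => h ->.
  - by move=> [j i]; rewrite mem_slots => h ->.
case: c => [[j|//|j i|j i]|j i] /= h; apply/or4P.
- apply: Or41; apply/mapP; exists j.-1; first by rewrite mem_iota; lia.
  by rewrite prednK //; lia.
- by apply: Or42; apply/mapP; exists (j, i); rewrite ?mem_slots.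
- by apply: Or43; apply/mapP; exists (j, i); rewrite ?mem_slots.
- by apply: Or44; apply/mapP; exists (j, i); rewrite ?mem_slots.
Qed.

Lemma elabels_uniq n : uniq (elabels n).
Proof.
rewrite !cat_uniq !map_inj_uniq ?slots_uniq ?iota_uniq //=;
  try by [move=> ? ? []|move=> [? ?] [? ?] [/= -> ->]].
rewrite andbT; apply/and3P; split.
- apply/hasPn => c; rewrite !mem_cat => /or3P[] /mapP[p _ ->];
  by apply/mapP => -[].
- apply/hasPn => c; rewrite !mem_cat => /orP[] /mapP[p _ ->];
  by apply/mapP => -[].
- by apply/hasPn => c /mapP[p _ ->]; apply/mapP => -[].
Qed.

(** * Weights of height functions by summation by parts *)

Section LabelSums.
Variable R : realFieldType.
Implicit Types (n k r K : nat) (a h : nat -> nat -> R) (H : nat -> nat -> nat).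

Lemma big_elabels n (F : elabel -> R) :
  \sum_(c <- elabels n) F c = \sum_(0 <= K < n) (F (Hor (Src K.+1)) +
    \sum_(0 <= i < K) (F (Hor (Hd K i.+1)) + F (Hor (Tl K i.+1)) + F (Slant K i.+1))).
Proof.
rewrite !big_cat !big_map /= !big_allpairs_dep /= big_split /= /index_iota subn0.
congr (_ + _); under [in RHS]eq_bigr do rewrite subn0 !big_split /=.
by rewrite !big_split /= addrA.
Qed.

(* The pattern is indexed by a j i = lambda^j_(i+1). *)
Definition pattern_weight a (c : elabel) : R :=
  match c with
  | Hor (Src j) => a j 0%N
  | Hor (Tl j i) => a j.+1 i - a j i.-1
  | _ => 0
  end.

(** The contribution of the line y = K + 1, where [pattern_weight] can be nonzero only on the source
    edge and on the edges leaving tails. *)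
Definition line_weight a h K : R :=
  a K.+1 0%N * (h K.+1 0%N - h K 0%N) +
  \sum_(0 <= i < K) (a K.+1 i.+1 - a K i) * (h K.+1 i.+1 - h K i.+1).

(** When [h] comes from a multipath and K < n, this adds up lambda^K_{i+1} over the slanted edges
    e_{K,i+1} that it does not use. *)
Definition line_bound a h K : R :=
  \sum_(0 <= i < K) a K i * (1 - h K i.+1 + h K i).

(** Summation by parts. The correction pairs the gaps lambda^{K+1}_{i+1} - lambda^K_{i+1} with one
    minus the jump across the edge leaving the head of e_{K+1,i+1}. *)
Lemma line_weightE a h K : h K.+1 K.+1 = h K K + 1 ->
  line_weight a h K = line_bound a h K.+1 - line_bound a h K -
    \sum_(0 <= i < K) (a K.+1 i - a K i) * (1 - h K.+1 i.+1 + h K i).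
Proof.
move=> hK; rewrite /line_weight /line_bound.
have -> : \sum_(0 <= i < K) (a K.+1 i.+1 - a K i) * (h K.+1 i.+1 - h K i.+1) =
    \sum_(0 <= i < K) a K.+1 i.+1 * (h K.+1 i.+1 - h K i.+1) -
    \sum_(0 <= i < K) a K i * (h K.+1 i.+1 - h K i.+1).
  by rewrite -sumrB; apply: eq_bigr => i _; rewrite mulrBl.
rewrite addrA -(big_nat_recl _ _ (fun i => a K.+1 i * (h K.+1 i - h K i))) //.
rewrite !big_nat_recr //= hK.
have -> : \sum_(0 <= i < K) a K.+1 i * (1 - h K.+1 i.+1 + h K.+1 i) =
    \sum_(0 <= i < K) a K i * (1 - h K i.+1 + h K i) +
    \sum_(0 <= i < K) (a K.+1 i - a K i) * (1 - h K.+1 i.+1 + h K i) +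
    \sum_(0 <= i < K) a K.+1 i * (h K.+1 i - h K i) -
    \sum_(0 <= i < K) a K i * (h K.+1 i.+1 - h K i.+1).
  by rewrite -!big_split -sumrB /=; apply: eq_bigr => i _; ring.
ring.
Qed.

Lemma sum_line_weight a h k : (forall K, (K < k)%N -> h K.+1 K.+1 = h K K + 1) ->
  \sum_(0 <= K < k) line_weight a h K = line_bound a h k -
    \sum_(0 <= K < k) \sum_(0 <= i < K)
      (a K.+1 i - a K i) * (1 - h K.+1 i.+1 + h K i).
Proof.
elim: k => [|k IHk] hd; first by rewrite !big_nil /line_bound big_nil subr0.
rewrite !big_nat_recr //= IHk => [|K Kk]; last by apply: hd; exact: leqW.
by rewrite line_weightE ?hd //; ring.
Qed.

Lemma label_weightE n k r a H : height n k r H -> (k <= n)%N ->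
  \sum_(c <- elabels n) pattern_weight a c * (flow H c)%:R =
  \sum_(0 <= K < k) line_weight a (fun j i => (H j i)%:R) K.
Proof.
move=> hH kn; have [_ hr _] := hH.
have fE c : valid_elabel n c -> (flow H c)%:R = (upper H c)%:R - (lower H c)%:R :> R.
  by move=> /(flowE hH) ->; rewrite natrD addrAC subrr add0r.
rewrite big_elabels /=; transitivity
  (\sum_(0 <= K < n) line_weight a (fun j i => (H j i)%:R) K).
  apply: eq_big_nat => K Kn; rewrite fE //=; congr (_ + _).
  apply: eq_big_nat => i iK; rewrite (fE (Hor (Tl K i.+1))) /=; last by rewrite /slot; lia.
  by rewrite !mul0r add0r addr0.
(* From line [k] on all heights equal [r], so the lines above it contribute nothing. *)
rewrite (big_cat_nat (n := k)) //= [X in _ + X]big_nat_cond [X in _ + X]big1 ?addr0 // => K.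
rewrite andbT => hK; rewrite /line_weight !hr ?subrr ?mulr0 ?add0r //; try lia.
rewrite big_nat_cond big1 // => i; rewrite andbT => hi.
by rewrite !hr ?subrr ?mulr0 //; lia.
Qed.

Definition interlacing n a : Prop := forall j i, (i < j)%N -> (j < n)%N ->
  a j i <= a j.+1 i /\ a j.+1 i.+1 <= a j i.

(** The function max(r, i) of i has jump 0 before r and jump 1 afterwards, so exactly the first [r]
    entries survive. *)
Lemma line_bound_max a k r : (r <= k)%N ->
  line_bound a (fun j i => (maxn r i)%:R) k = \sum_(0 <= i < r) a k i.
Proof.
move=> rk; rewrite /line_bound (big_cat_nat (n := r)) //=.
rewrite [X in _ + X]big_nat_cond [X in _ + X]big1 ?addr0 => [|i].
  apply: eq_big_nat => i hi; rewrite (maxn_idPl _) ?(maxn_idPl _); [|lia|lia].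
  by rewrite subrK mulr1.
rewrite andbT => hi; rewrite (maxn_idPr _) ?(maxn_idPr _); [|lia|lia].
by rewrite -natr1; ring.
Qed.

(** [H j j] counts the paths ending at the sinks 1, ..., j, and the edge into each sink carries at
    most one. *)
Lemma diagonal_le n k r H j : (k <= n)%N -> height n k r H -> (j <= k)%N ->
  (H j j <= j)%N.
Proof.
move=> kn [h0 hr hc]; elim: j => [|j IHj] jk; first by rewrite h0.
have {IHj} hj := IHj ltac:(lia); have [jn|jn] := ltnP j.+1 n.
  by have := hc (Hor (Hd j.+1 j.+1)); rewrite /= /slot; lia.
(* The edge into the top sink starts at the tail of e_{n-1,n-1}, or at the source when n = 1. *)
have e : n = j.+1 by lia.
rewrite hr; [|lia|lia]; rewrite -(hr j.+1 j); [|lia|lia].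
case: j hj jk jn e => [|j] hj jk jn e.
  by have := hc (Hor (Src 1)); rewrite /=; lia.
by have := hc (Hor (Tl j.+1 j.+1)); rewrite /= /slot; lia.
Qed.

(* The paths of rank at most i may be discarded after the i-th slanted edges, where
   the remaining weights are nonpositive: this replaces H j i by max (H j i) i. *)
Lemma label_weight_le n k r a H : (r <= k <= n)%N -> interlacing n a ->
  height n k r H ->
  \sum_(c <- elabels n) pattern_weight a c * (flow H c)%:R <=
  \sum_(0 <= i < r) a k i.
Proof.
move=> /andP[rk kn] ia hH; rewrite (label_weightE _ hH kn).
have [h0 hr hc] := hH.
pose h j i : R := (maxn (H j i) i)%:R.
have hd K : (K <= k)%N -> h K K = K%:R.
  by move=> Kk; rewrite /h (maxn_idPr _) //; exact: diagonal_le hH Kk.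
apply: (@le_trans _ _ (\sum_(0 <= K < k) line_weight a h K)).
  rewrite [leLHS]big_nat [leRHS]big_nat; apply: ler_sum => K Kk.
  rewrite /line_weight /h !maxn0; apply: lerD => //.
  rewrite [leLHS]big_nat [leRHS]big_nat; apply: ler_sum => i iK.
  (* Clipping both heights from below at i + 1 can only shrink their difference, and its coefficient
     is nonpositive. *)
  have [_ le_a] := ia K i ltac:(lia) ltac:(lia).
  rewrite -subr_ge0 -mulrBr; apply: mulr_le0; first by rewrite subr_le0.
  have := hc (Hor (Tl K i.+1)); rewrite /= /slot => /(_ ltac:(lia)) le_h.
  by rewrite subr_le0 lerBlDr addrAC lerBrDr -!natrD ler_nat; lia.
rewrite sum_line_weight => [|K Kk]; last by rewrite !hd ?natr1 //; lia.
rewrite -[leRHS](line_bound_max _ rk).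
have -> : line_bound a h k = line_bound a (fun j i => (maxn r i)%:R) k.
  by apply: eq_big_nat => i ik; rewrite /h !hr //; lia.
rewrite gerBl big_nat_cond; apply: sumr_ge0 => K; rewrite andbT => Kk.
rewrite big_nat_cond; apply: sumr_ge0 => i; rewrite andbT => iK.
have [le_a _] := ia K i ltac:(lia) ltac:(lia).
apply: mulr_ge0; first by rewrite subr_ge0.
suff : (maxn (H K.+1 i.+1) i.+1 <= maxn (H K i) i + 1)%N.
  by rewrite -(ler_nat R) natrD /h; lra.
have [Kn|Kn] := ltnP K.+1 n.
  by have := hc (Hor (Hd K.+1 i.+1)); rewrite /= /slot; lia.
(* The top line has no heads. There the height is constant, so the edge separating the face (K, i)
   from the unbounded face gives the bound. *)
rewrite hr; [|lia|lia]; rewrite -(hr K.+1 i); [|lia|lia].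
case: i iK {le_a} => [|i] iK; first by have := hc (Hor (Src K.+1)); rewrite /=; lia.
by have := hc (Hor (Tl K i.+1)); rewrite /= /slot; lia.
Qed.

(** For the standard heights, clipping leaves the weight unchanged and all correction terms vanish,
    so the estimates behind [label_weight_le] become equalities. *)
Lemma label_weight_standard n k r a : (r <= k <= n)%N ->
  \sum_(c <- elabels n) pattern_weight a c * (flow (standard_height k r) c)%:R =
  \sum_(0 <= i < r) a k i.
Proof.
move=> h; have [rk kn] := andP h.
rewrite (label_weightE _ (standard_heightP h) kn).
pose g j i : R := (maxn (standard_height k r j i) i)%:R.
transitivity (\sum_(0 <= K < k) line_weight a g K).
  apply: eq_big_nat => K Kk; rewrite /line_weight /g !maxn0; congr (_ + _).
  apply: eq_big_nat => i iK; congr (_ * _); rewrite /standard_height.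
  (* If r <= i + 1, both heights are [r] before clipping and both are i + 1 after it; otherwise
     clipping at i + 1 has no effect. *)
  have [ri|ri] := leqP r i.+1.
    rewrite !(minn_idPl _) ?subrr //; lia.
  by congr (_%:R - _%:R); lia.
rewrite sum_line_weight => [|K Kk]; last first.
  by rewrite /g /standard_height natr1; congr _%:R; lia.
rewrite [X in _ - X]big_nat_cond big1 ?subr0 => [|K]; last first.
  rewrite andbT => Kk; rewrite big_nat_cond big1 // => i; rewrite andbT => iK.
  rewrite /g /standard_height.
  suff -> : maxn (minn r (maxn i.+1 (K.+1 - (k - r)))) i.+1 =
    (maxn (minn r (maxn i (K - (k - r)))) i + 1)%N by rewrite natrD; ring.
  lia.
rewrite -(line_bound_max _ rk); apply: eq_big_nat => i ik.
by rewrite /g /standard_height; congr (_ * (1 - _%:R + _%:R)); lia.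
Qed.

End LabelSums.

(** * Labelling of the network *)

Definition is_src (l : vlabel) : bool := if l is Src _ then true else false.
Definition is_snk (l : vlabel) : bool := if l is Snk _ then true else false.

Definition vlabel_line (l : vlabel) : nat :=
  match l with Src j | Snk j | Hd j _ => j | Tl j _ => j.+1 end.

(** Increases from left to right along each line; 2n + 1 exceeds every internal rank. *)
Definition vlabel_rank (n : nat) (l : vlabel) : nat :=
  match l with
  | Src _ => 0 | Hd _ i => (2 * i).-1 | Tl _ i => 2 * i | Snk _ => (2 * n).+1
  end%N.

(** The later arguments use the embedding only through these properties; [lab_line] serves to read
    off the truncations. *)
Record labelling (R : realType) (n : nat) (G : planarNetwork R)
    (lab : G -> vlabel) (code : edge G -> elabel) : Prop := {
  lab_inj : injective lab;
  lab_valid : forall v, valid_vlabel n (lab v);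
  lab_surj : forall l, valid_vlabel n l -> exists v, lab v = l;
  code_inj : injective code;
  code_valid : forall e, valid_elabel n (code e);
  code_surj : forall c, valid_elabel n c -> exists e, code e = c;
  lab_tail : forall e, lab (edge_tail e) = elabel_tail (code e);
  lab_head : forall e, lab (edge_head e) = elabel_head n (code e);
  lab_source : forall v, is_source v = is_src (lab v);
  lab_sink : forall v, is_sink v = is_snk (lab v);
  lab_line : forall v, (pos v).2 = (vlabel_line (lab v))%:R }.

Lemma vlabel_rank_inj n l l' : valid_vlabel n l -> valid_vlabel n l' ->
  vlabel_line l = vlabel_line l' -> vlabel_rank n l = vlabel_rank n l' -> l = l'.
Proof.
case: l => [j|j|j i|j i]; case: l' => [j'|j'|j' i'|j' i'] /=; rewrite /slot => *;
  first [lia | congr Src; lia | congr Snk; lia | congr Hd; lia | congr Tl; lia].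
Qed.

Lemma next_vlabel_line n l : valid_vlabel n l ->
  vlabel_line (next_vlabel n l) = vlabel_line l.
Proof.
by case: l => [j|j|j i|j i] //=; rewrite /slot => h; do 2?[case: ifPn => /= ?]; lia.
Qed.

(** No vertex of the line lies strictly between a label and its successor; this identifies the
    horizontal edges. *)
Lemma next_vlabel_rank n l l' : valid_vlabel n l -> valid_vlabel n l' ->
  vlabel_line l = vlabel_line l' -> (vlabel_rank n l < vlabel_rank n l')%N ->
  (vlabel_rank n (next_vlabel n l) <= vlabel_rank n l')%N.
Proof.
case: l => [j|j|j i|j i]; case: l' => [j'|j'|j' i'|j' i'] //=; rewrite /slot;
  do 2?[case: ifPn => /= ?]; lia.
Qed.

Lemma lt_next_vlabel_rank n l : valid_vlabel n l -> ~~ is_snk l ->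
  (vlabel_rank n l < vlabel_rank n (next_vlabel n l))%N.
Proof.
by case: l => [j|j|j i|j i] //=; rewrite /slot; do 2?[case: ifPn => /= ?]; lia.
Qed.

(** * Reading the labels off the layout *)

Section Layout.
Variables (R : realType) (n : nat) (G : planarNetwork R).
Variables (xt xh : nat -> nat -> R) (layout : Gamma0_layout n G xt xh).

Definition vlabel_pos (l : vlabel) : R * R :=
  match l with
  | Src j => (xmin G, j%:R) | Snk j => (xmax G, j%:R)
  | Hd j i => (xh j i, j%:R) | Tl j i => (xt j i, j.+1%:R)
  end.

Lemma vlabel_pos_line l : (vlabel_pos l).2 = (vlabel_line l)%:R.
Proof. by case: l. Qed.

Lemma vertex_of l : valid_vlabel n l -> exists v : G, pos v = vlabel_pos l.
Proof.
case: l => [j|j|j i|j i] /= h.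
- by apply/(layout_rank layout).1; exists j.
- by apply/(layout_rank layout).2; exists j.
- have [_ [|v _ e]] := layout_internal layout (xh j i, j%:R); last by exists v.
  by exists j, i; move: h; rewrite /slot => ?; split; [lia|split; [lia|right]].
- have [_ [|v _ e]] := layout_internal layout (xt j i, j.+1%:R); last by exists v.
  by exists j, i; move: h; rewrite /slot => ?; split; [lia|split; [lia|left]].
Qed.

Lemma internal_vlabel_pos l : valid_vlabel n l -> internal_vlabel l ->
  xmin G < (vlabel_pos l).1 < xmax G.
Proof.
move=> vl il; have [v iv vE] : exists2 v : G, is_internal v & pos v = vlabel_pos l.
  apply/(layout_internal layout); case: l vl il => //= j i.
    by rewrite /slot => /and3P[? ? ?] _; exists j, i; split; [lia|split => //; right].
  by rewrite /slot => /and3P[? ? ?] _; exists j, i; split; [lia|split => //; left].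
have /andP[h1 h2] := pos_strip v; rewrite -vE !lt_neqAle h1 h2 !andbT.
by move: iv; rewrite /is_internal /is_source /is_sink eq_sym.
Qed.

Lemma vertex_label (v : G) : exists l, valid_vlabel n l /\ vlabel_pos l = pos v.
Proof.
have [sv|sv] := boolP (is_source v).
  have [h _] := (layout_rank layout).1 (pos v).2.
  have [|j hj e] := h; first by exists v; rewrite -(eqP sv) -surjective_pairing.
  by exists (Src j); split => //=; rewrite -e -(eqP sv) -surjective_pairing.
have [tv|tv] := boolP (is_sink v).
  have [h _] := (layout_rank layout).2 (pos v).2.
  have [|j hj e] := h; first by exists v; rewrite -(eqP tv) -surjective_pairing.
  by exists (Snk j); split => //=; rewrite -e -(eqP tv) -surjective_pairing.
have [h _] := layout_internal layout (pos v).
have [|j [i [hi [hj [e|e]]]]] := h; first by exists v; rewrite // /is_internal sv.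
  by exists (Tl j i); rewrite /= /slot e; split => //; lia.
by exists (Hd j i); rewrite /= /slot e; split => //; lia.
Qed.

(** On an inner line a head separates two consecutive tails; on the top line the layout prescribes
    the order. *)
Lemma xt_ltS j i : (0 < i < j)%N -> (j < n)%N -> xt j i < xt j i.+1.
Proof.
move=> hi jn; have [jn1|jn1] := ltnP j.+1 n.
  have /andP[_ h] := @layout_order _ _ _ _ _ layout j.+1 i ltac:(lia) ltac:(lia).
  have /andP[h' _] := @layout_order _ _ _ _ _ layout j.+1 i.+1 ltac:(lia) ltac:(lia).
  exact: lt_trans h h'.
have := @layout_order_top _ _ _ _ _ layout i ltac:(lia) ltac:(lia).
by have -> : j = n.-1 by lia.
Qed.

Lemma xh_ltS j i : (0 < i < j)%N -> (j < n)%N -> xh j i < xh j i.+1.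
Proof.
move=> hi jn.
have /andP[h h'] := @layout_order _ _ _ _ _ layout j i ltac:(lia) ltac:(lia).
exact: lt_trans h h'.
Qed.

Lemma chain_le (f : nat -> R) j i i' :
  (forall i, (0 < i < j)%N -> f i < f i.+1) ->
  (0 < i)%N -> (i <= i' <= j)%N -> f i <= f i'.
Proof.
move=> hf i0; elim: i' => [|i' IH] hi; first by have -> : i = 0%N by lia.
have [->//|ne] := eqVneq i i'.+1.
by apply: le_trans (IH _) (ltW (hf _ _)); lia.
Qed.

Lemma chain_lt (f : nat -> R) j i i' :
  (forall i, (0 < i < j)%N -> f i < f i.+1) ->
  (0 < i)%N -> (i < i' <= j)%N -> f i < f i'.
Proof.
move=> hf i0 hi; apply: (@lt_le_trans _ _ (f i.+1)); first by apply: hf; lia.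
by apply: (chain_le hf); lia.
Qed.

Lemma vlabel_pos_lt l l' : valid_vlabel n l -> valid_vlabel n l' ->
  vlabel_line l = vlabel_line l' -> (vlabel_rank n l < vlabel_rank n l')%N ->
  (vlabel_pos l).1 < (vlabel_pos l').1.
Proof.
move=> vl vl'; have := internal_vlabel_pos vl; have := internal_vlabel_pos vl'.
have := xmin_lt_xmax G; move: vl vl'.
case: l => [j|j|j i|j i]; case: l' => [j'|j'|j' i'|j' i'] //=; rewrite /slot
  => vl vl' mM h' h e r; try by [lia | case/andP: (h isT) | case/andP: (h' isT)].
- have ? : j' = j by lia. subst j'.
  by apply: (@chain_lt (xh j) j) => [k hk||]; [apply: xh_ltS; lia|lia|lia].
- have ? : j = j'.+1 by lia. subst j.
  have /andP[h1 _] := @layout_order _ _ _ _ _ layout j'.+1 i' ltac:(lia) ltac:(lia).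
  apply: le_lt_trans h1.
  by apply: (@chain_le (xh j'.+1) j'.+1) => [k hk||]; [apply: xh_ltS; lia|lia|lia].
- have ? : j' = j.+1 by lia. subst j'.
  have /andP[_ h1] := @layout_order _ _ _ _ _ layout j.+1 i ltac:(lia) ltac:(lia).
  apply: (lt_le_trans h1).
  by apply: (@chain_le (xh j.+1) j.+1) => [k hk||]; [apply: xh_ltS; lia|lia|lia].
- have ? : j' = j by lia. subst j'.
  by apply: (@chain_lt (xt j) j) => [k hk||]; [apply: xt_ltS; lia|lia|lia].
Qed.

Lemma vlabel_pos_line_inj l l' : (vlabel_pos l).2 = (vlabel_pos l').2 ->
  vlabel_line l = vlabel_line l'.
Proof. by rewrite !vlabel_pos_line => /eqP; rewrite eqr_nat => /eqP. Qed.

Lemma vlabel_pos_lt_rank l l' : valid_vlabel n l -> valid_vlabel n l' ->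
  vlabel_line l = vlabel_line l' -> (vlabel_pos l).1 < (vlabel_pos l').1 ->
  (vlabel_rank n l < vlabel_rank n l')%N.
Proof.
move=> vl vl' e lt; rewrite ltnNge leq_eqVlt; apply/negP => /orP[/eqP r|r].
  by move: lt; rewrite (vlabel_rank_inj vl' vl (esym e) r) ltxx.
by have := lt_trans lt (vlabel_pos_lt vl' vl (esym e) r); rewrite ltxx.
Qed.

Lemma vlabel_pos_inj l l' : valid_vlabel n l -> valid_vlabel n l' ->
  vlabel_pos l = vlabel_pos l' -> l = l'.
Proof.
move=> vl vl' e; have el : vlabel_line l = vlabel_line l'.
  by apply: vlabel_pos_line_inj; rewrite e.
apply: (vlabel_rank_inj vl vl' el); apply/eqP; rewrite eqn_leq.
apply/andP; split; rewrite leqNgt; apply/negP => r.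
  by have := vlabel_pos_lt vl' vl (esym el) r; rewrite e ltxx.
by have := vlabel_pos_lt vl vl' el r; rewrite e ltxx.
Qed.

(** Abscissas on a line are ordered as the ranks. Since a horizontal edge joins consecutive
    vertices, the label of its tail determines its head. *)
Lemma layout_labelling :
  exists (lab : G -> vlabel) (code : edge G -> elabel), labelling n lab code.
Proof.
have [lab labP] := choice vertex_label.
have labV v : valid_vlabel n (lab v) by have [] := labP v.
have labE v : vlabel_pos (lab v) = pos v by have [] := labP v.
have lab_eq v l : valid_vlabel n l -> pos v = vlabel_pos l -> lab v = l.
  by move=> vl e; apply: vlabel_pos_inj; rewrite ?labE.
have labI : injective lab.
  by move=> u v e; apply: pos_inj; rewrite -!labE e.
have code_ex (e : edge G) : exists c, [/\ valid_elabel n c,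
    lab (edge_tail e) = elabel_tail c & lab (edge_head e) = elabel_head n c].
  have := valP e; rewrite -/(edge_tail e) -/(edge_head e).
  set u := edge_tail e; set v := edge_head e => uv.
  have := (layout_edge layout u v).1 uv.
  move=> [[j [i [hi [hj [hu hv]]]]]|[e2 lt btw]].
    have hji : slot n j i by rewrite /slot; lia.
    by exists (Slant j i); split => //=; apply: lab_eq.
  have el : vlabel_line (lab u) = vlabel_line (lab v).
    by apply: vlabel_pos_line_inj; rewrite !labE.
  have rk : (vlabel_rank n (lab u) < vlabel_rank n (lab v))%N.
    by apply: vlabel_pos_lt_rank; rewrite ?labE.
  have su : ~~ is_snk (lab u).
    apply/negP; case E : (lab u) => [|j||] // _; move: rk; rewrite E /=.
    have := labV v; case: (lab v) => [||j' i'|j' i'] /=; rewrite /slot; lia.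
  have vu : valid_elabel n (Hor (lab u)).
    by move: su (labV u); rewrite /=; case: (lab u).
  exists (Hor (lab u)); split => //=.
  have vn := elabel_head_valid vu.
  have ln := next_vlabel_line (labV u).
  have := next_vlabel_rank (labV u) (labV v) el rk.
  rewrite leq_eqVlt => /orP[/eqP r|r].
    by apply/esym; apply: (@vlabel_rank_inj n); rewrite ?ln.
  (* Otherwise the successor would be a vertex strictly inside the edge. *)
  have [w wE] := vertex_of vn; case: (btw w).
    by rewrite wE -labE !vlabel_pos_line ln.
  rewrite wE -2!labE; apply/andP; split; apply: vlabel_pos_lt => //=.
  - exact: lt_next_vlabel_rank.
  - by rewrite ln.
have [code codeP] := choice code_ex.
exists lab, code; split => //.
- by move=> l vl; have [v vE] := vertex_of vl; exists v; exact: lab_eq.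
- move=> e e' ee; have [_ t h] := codeP e; have [_ t' h'] := codeP e'.
  apply/val_inj; rewrite /= (surjective_pairing (\val e)) (surjective_pairing (\val e')).
  congr (_, _); apply: labI.
    by move: t t'; rewrite /edge_tail ee => -> ->.
  by move: h h'; rewrite /edge_head ee => -> ->.
- by move=> e; have [] := codeP e.
- move=> c vc.
  have vt := elabel_tail_valid vc; have vh := elabel_head_valid vc.
  have [u uE] := vertex_of vt; have [v vE] := vertex_of vh.
  have uv : edge_rel u v.
    apply/(layout_edge layout); case: c vc vt vh uE vE => [l|j i] /= vc vt vh uE vE.
      right; have ln := next_vlabel_line vt.
      have sl : ~~ is_snk l by case: l vc {vt vh uE vE ln}.
      rewrite uE vE; split; first by rewrite !vlabel_pos_line ln.
        by apply: vlabel_pos_lt => //; exact: lt_next_vlabel_rank.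
      move=> w; rewrite -labE => e2 /andP[h1 h2].
      have e3 := vlabel_pos_line_inj e2.
      have r1 := vlabel_pos_lt_rank vt (labV w) (esym e3) h1.
      have r2 := vlabel_pos_lt_rank (labV w) vh (etrans e3 (esym ln)) h2.
      by have := next_vlabel_rank vt (labV w) (esym e3) r1; rewrite leqNgt r2.
    left; exists j, i; move: vc; rewrite /slot => /and3P[? ? ?].
    by split; [lia|rewrite uE vE].
  exists (exist (fun p : G * G => is_true (edge_rel p.1 p.2)) (u, v) uv).
  set e := exist _ _ _; have [v' t h] := codeP e.
  apply: (@elabel_inj n) => //; rewrite -?t -?h.
    exact: lab_eq.
  exact: lab_eq.
- by move=> e; have [] := codeP e.
- by move=> e; have [] := codeP e.
- move=> v; rewrite /is_source -labE; have := labV v => /internal_vlabel_pos.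
  case: (lab v) => [j|j|j i|j i] /=; rewrite ?eqxx //.
  + by rewrite gt_eqF // xmin_lt_xmax.
  + by move=> /(_ isT) /andP[h _]; rewrite gt_eqF.
  + by move=> /(_ isT) /andP[h _]; rewrite gt_eqF.
- move=> v; rewrite /is_sink -labE; have := labV v => /internal_vlabel_pos.
  case: (lab v) => [j|j|j i|j i] /=; rewrite ?eqxx //.
  + by rewrite lt_eqF // xmin_lt_xmax.
  + by move=> /(_ isT) /andP[_ h]; rewrite lt_eqF.
  + by move=> /(_ isT) /andP[_ h]; rewrite lt_eqF.
- by move=> v; rewrite -labE vlabel_pos_line.
Qed.

End Layout.

(** * Multipaths and height functions *)

Section Multipaths.
Variables (R : realType) (n : nat) (G : planarNetwork R).
Variables (lab : G -> vlabel) (code : edge G -> elabel).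
Hypothesis LG : labelling n lab code.
Implicit Types (A : pregraph G) (H : nat -> nat -> nat).

Definition used A (c : elabel) : nat := [exists e in A.2, code e == c].

Lemma used_code A e : used A (code e) = (e \in A.2).
Proof.
congr nat_of_bool; apply/existsP/idP => [[e' /andP[eA /eqP/(code_inj LG) <-]]|eA] //.
by exists e; rewrite eA eqxx.
Qed.

Lemma usedP A c : (0 < used A c)%N -> exists2 e, e \in A.2 & code e = c.
Proof.
by rewrite lt0b => /existsP[e /andP[eA /eqP ec]]; exists e.
Qed.

Lemma card_used A (s : seq elabel) : uniq s ->
  #|[set e in A.2 | code e \in s]%SET| = (\sum_(c <- s) used A c)%N.
Proof.
move=> us; rewrite cardE -(size_map code).
transitivity (size [seq c <- s | [exists e in A.2, code e == c]]).
  apply: perm_size; apply: uniq_perm.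
  - by rewrite (map_inj_uniq (code_inj LG)) enum_uniq.
  - exact: filter_uniq.
  - move=> c; rewrite mem_filter; apply/mapP/andP => [[e]|[/existsP[e /andP[eA /eqP ec]] cs]].
      rewrite mem_enum finset.in_set => /andP[eA es] ->; split => //.
      by apply/existsP; exists e; rewrite eA eqxx.
    by exists e => //; rewrite mem_enum finset.in_set eA ec.
by rewrite size_filter -sum1_count big_mkcond.
Qed.

Lemma indegreeE A v : indegree A v = (\sum_(c <- in_elabels n (lab v)) used A c)%N.
Proof.
rewrite -card_used ?in_elabels_uniq // /indegree; apply: eq_card => e.
rewrite !finset.in_set -(in_elabelsP (lab_valid LG v) (code_valid LG e)) -(lab_head LG).
by rewrite (inj_eq (lab_inj LG)).
Qed.

Lemma outdegreeE A v : outdegree A v = (\sum_(c <- out_elabels (lab v)) used A c)%N.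
Proof.
rewrite -card_used ?out_elabels_uniq // /outdegree; apply: eq_card => e.
rewrite !finset.in_set -(out_elabelsP _ (code_valid LG e)) -(lab_tail LG).
by rewrite (inj_eq (lab_inj LG)).
Qed.

Lemma internalE v : is_internal v = internal_vlabel (lab v).
Proof.
by rewrite /is_internal (lab_source LG) (lab_sink LG); case: (lab v).
Qed.

Lemma multipath_edge A e : multipath A -> e \in A.2 ->
  edge_tail e \in A.1 /\ edge_head e \in A.1.
Proof. by move=> /and3P[/forall_inP h _ _] /h /andP. Qed.

(** A source of a multipath is not isolated and has no incoming edge, so its only outgoing edge is
    used. *)
Lemma nsourcesE A : multipath A ->
  nsources A = (\sum_(0 <= a < n) used A (Hor (Src a.+1)))%N.
Proof.
move=> mA; have [_ /forall_inP hdeg _] := and3P mA.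
rewrite /index_iota subn0 -(big_map (fun a => Hor (Src a.+1)) xpredT (used A)).
rewrite -card_used; last first.
  by rewrite map_inj_uniq ?iota_uniq // => ? ? [].
have srcP e : (code e \in [seq Hor (Src a.+1) | a <- iota 0 n]) =
    is_src (lab (edge_tail e)).
  rewrite (lab_tail LG); have := code_valid LG e.
  case: (code e) => [[j|j|j i|j i]|j i] v /=; apply/mapP => //=; try by case.
  by exists j.-1; [rewrite mem_iota; move: v => /=; lia|rewrite prednK //; case/andP: v].
rewrite /nsources; transitivity (#|(fun e : edge G => edge_tail e) @: [set e in A.2 |
    code e \in [seq Hor (Src a.+1) | a <- iota 0 n]]|)%SET.
  congr #|pred_of_set _|; apply/setP => v; rewrite finset.in_set; apply/andP/imsetP.
    move=> [vA]; rewrite (lab_source LG) => sv; have := hdeg _ vA.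
    rewrite indegreeE outdegreeE; case E : (lab v) sv => [j|//|//|//] _ /=.
    rewrite big_nil big_seq1 add0n => /usedP[e eA ec].
    have te : edge_tail e = v by apply: (lab_inj LG); rewrite (lab_tail LG) ec E.
    by exists e => //; rewrite finset.in_set eA srcP te E.
  move=> [e]; rewrite finset.in_set srcP => /andP[eA se] ->.
  by rewrite (lab_source LG); have [] := multipath_edge mA eA.
rewrite card_in_imset // => e e'; rewrite !finset.in_set !srcP => /andP[_ s] /andP[_ s'] te.
apply: (code_inj LG); move: s s' (congr1 lab te); rewrite !(lab_tail LG).
have := code_valid LG e; have := code_valid LG e'.
by case: (code e) => [[]|] //= j; case: (code e') => [[]|] //= j' _ _ _ _ ->.
Qed.

Lemma multipath_conservation A l : multipath A ->
  valid_vlabel n l -> internal_vlabel l ->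
  (\sum_(c <- in_elabels n l) used A c = \sum_(c <- out_elabels l) used A c)%N.
Proof.
move=> mA vl il; have [v vE] := lab_surj LG vl.
rewrite -vE -indegreeE -outdegreeE.
have [vA|vA] := boolP (v \in A.1).
  have [_ _ /forall_inP h] := and3P mA.
  by have := h _ vA; rewrite internalE vE il => /andP[/eqP -> /eqP ->].
rewrite /indegree /outdegree !eq_card0 // => e; rewrite finset.in_set;
  apply/negbTE/negP => /andP[/(multipath_edge mA)[h1 h2] /eqP e_];
  by move: vA; rewrite -e_ ?h1 ?h2.
Qed.

(** Source edges and slanted edges determine the height; conservation at internal vertices then
    yields its jumps across the other horizontal edges. *)
Lemma multipath_height A k r : (k <= n)%N -> A \in paths (truncation G k) r ->
  exists2 H, height n k r H & forall e, (e \in A.2) = flow H (code e) :> nat.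
Proof.
move=> kn; rewrite finset.in_set => /and4P[mA A1 A2 /eqP rA].
pose x c := used A c.
pose H j i : nat := (\sum_(0 <= a < j) x (Hor (Src a.+1)) +
  (if j < n then \sum_(0 <= b < i) x (Slant j b.+1) else 0))%N.
have H_0 j : (H j 0 = \sum_(0 <= a < j) x (Hor (Src a.+1)))%N.
  by rewrite /H [X in if _ then X else _]big_geq // if_same addn0.
have H_Src j : (j < n)%N -> (H j.+1 0 = H j 0 + x (Hor (Src j.+1)))%N.
  by move=> _; rewrite !H_0 big_nat_recr.
have H_Slant j i : (j < n)%N -> (H j i.+1 = H j i + x (Slant j i.+1))%N.
  by move=> jn; rewrite /H jn big_nat_recr //= addnA.
have Hn i : H n i = r.
  by rewrite /H ltnn addn0 -rA nsourcesE.
have cons l : valid_vlabel n l -> internal_vlabel l -> 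
  (\sum_(c <- in_elabels n l) x c = \sum_(c <- out_elabels l) x c)%N.
  exact: multipath_conservation.
(* Conservation is applied alternately at the heads and the tails of line [j], from left to
   right. *)
have H_line j : (j < n)%N -> forall i, (0 < i <= j)%N ->
    (H j i = H j.-1 i.-1 + x (Hor (Hd j i)))%N /\
    ((i < j)%N -> H j i = H j.-1 i + x (Hor (Tl j.-1 i)))%N.
  move=> jn; elim=> [//|i IHi] hi.
  have e1 : (H j i.+1 = H j.-1 i + x (Hor (Hd j i.+1)))%N.
    have := cons (Hd j i.+1); rewrite /= /slot => /(_ ltac:(lia) isT).
    rewrite !big_cons !big_nil; have := H_Slant j i jn.
    case: ifPn => i0.
      have -> : i = 0%N by lia.
      by have := H_Src j.-1; rewrite prednK; lia.
    by have [_] := IHi ltac:(lia); move=> /(_ ltac:(lia)) /=; lia.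
  split => // ij.
  have := cons (Tl j.-1 i.+1); rewrite /= /slot => /(_ ltac:(lia) isT).
  rewrite !big_cons !big_nil prednK ?jn; last lia.
  by have := H_Slant j.-1 i ltac:(lia); lia.
have H_top i : (0 < i <= n.-1)%N -> (H n i = H n.-1 i + x (Hor (Tl n.-1 i)))%N.
  elim: i => [//|i IHi] hi.
  have := cons (Tl n.-1 i.+1); rewrite /= /slot => /(_ ltac:(lia) isT).
  rewrite !big_cons !big_nil prednK ?ltnn; last lia.
  have := H_Slant n.-1 i ltac:(lia); have := Hn i; have := Hn i.+1.
  case: ifPn => i0.
    have -> : i = 0%N by lia.
    have := H_Src n.-1 ltac:(lia); have := Hn 0%N; rewrite prednK ?ltnn; last lia.
    lia.
  by have := IHi ltac:(lia); rewrite /=; lia.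
have HE c : valid_elabel n c -> upper H c = (lower H c + x c)%N.
  case: c => [[j|//|j i|j i]|j i] /=; rewrite ?/slot => v.
  - by have := H_Src j.-1; rewrite prednK; lia.
  - by have [-> _] := H_line j ltac:(lia) i ltac:(lia).
  - have [jn|jn] := ltnP j.+1 n.
      by have [_ /= ->] := H_line j.+1 jn i ltac:(lia); lia.
    have jE : j = n.-1 by lia.
    by have := H_top i; rewrite jE prednK; lia.
  - by have := H_Slant j i.-1; rewrite prednK; lia.
have H00 : (H 0 0 = 0)%N by rewrite H_0 big_geq.
have Hc c : valid_elabel n c -> (lower H c <= upper H c <= (lower H c).+1)%N.
  by move=> v; rewrite HE // /x /used; case: [exists e in _, _]; lia.
have hHn : height n n r H.
  split => // j i hj hi; have -> : j = n by lia.
  exact: Hn.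
exists H; last first.
  by move=> e; rewrite /flow HE ?(code_valid LG) // /x used_code; case: (e \in A.2); lia.
(* Sources above line [k] are outside the truncation, so the height at the left end stops growing
   there. *)
have Hk j : (k <= j <= n)%N -> H j 0%N = r.
  move=> hj; rewrite -(Hn 0%N) !H_0 [in RHS](big_cat_nat (n := j)) //=; [|lia].
  rewrite [X in (_ = _ + X)%N]big_nat_cond [X in (_ = _ + X)%N]big1 ?addn0 // => a.
  rewrite andbT => ha; apply/eqP; rewrite -leqn0 leqNgt; apply/negP => /usedP[e eA ec].
  have := fintype.subsetP A2 _ eA; rewrite finset.in_set => /andP[].
  rewrite finset.in_set (lab_source LG) (lab_line LG) (lab_tail LG) ec /= ltr_nat; lia.
split => // j i hj hi; apply/eqP; rewrite eqn_leq; apply/andP; split.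
  by apply: (height_le (leqnn n) hHn); lia.
by rewrite -(Hk j hj) H_0 leq_addr.
Qed.

(** The edges across which [H] jumps form the multipath. *)
Lemma height_multipath H k r : (k <= n)%N -> height n k r H ->
  exists2 A, A \in paths (truncation G k) r &
    forall e, (e \in A.2) = flow H (code e) :> nat.
Proof.
move=> kn hH; have [h0 hr hc] := hH.
pose A2 := [set e : edge G | upper H (code e) != lower H (code e)]%SET.
pose A1 := [set v : G | [exists e in A2, (edge_tail e == v) || (edge_head e == v)]]%SET.
pose A : pregraph G := (A1, A2).
have usedE c : valid_elabel n c -> used A c = flow H c.
  move=> /(code_surj LG)[e <-]; rewrite used_code /= finset.in_set //.
have sub : is_subgraph A.
  apply/forall_inP => e eA; rewrite !finset.in_set; apply/andP; split; apply/existsP;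
  by exists e; rewrite eA eqxx ?orbT.
have in_sum v : indegree A v = (\sum_(c <- in_elabels n (lab v)) flow H c)%N.
  rewrite indegreeE; apply: eq_big_seq => c cs; apply: usedE.
  exact: (allP (in_elabels_valid (lab_valid LG v))).
have out_sum v : outdegree A v = (\sum_(c <- out_elabels (lab v)) flow H c)%N.
  rewrite outdegreeE; apply: eq_big_seq => c cs; apply: usedE.
  exact: (allP (out_elabels_valid (lab_valid LG v))).
have deg v : v \in A.1 -> (0 < indegree A v + outdegree A v)%N.
  rewrite finset.in_set => /existsP[e /andP[eA /orP[] ev]]; rewrite addn_gt0; apply/orP;
    [right|left]; apply/card_gt0P; exists e; by rewrite finset.in_set eA ev.
have mA : multipath A.
  apply/and3P; split => //; apply/forall_inP => // v vA.
  apply/implyP; rewrite internalE => iv; have := deg _ vA.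
  have := height_conservation hH kn (lab_valid LG v) iv.
  rewrite -in_sum -out_sum => e.
  (* A head has one outgoing edge and a tail one incoming edge, so degrees that are equal and
     positive must be 1. *)
  have : (indegree A v <= 1)%N \/ (outdegree A v <= 1)%N.
    rewrite in_sum out_sum; case: (lab v) iv => //= j i _; [right|left];
    by rewrite big_seq1 /flow leq_b1.
  rewrite e; lia.
(* Heights are constant from line [k] on, so edges at sources or sinks above it carry no flow. *)
have A1k v : v \in A1 -> (is_source v || is_sink v) -> (vlabel_line (lab v) <= k)%N.
  move=> vA; have := deg _ vA; rewrite in_sum out_sum (lab_source LG) (lab_sink LG).
  have := lab_valid LG v.
  case: (lab v) => [j|j|j i|j i] //= vj; rewrite big_nil big_seq1 ?add0n ?addn0 => f _;
    rewrite leqNgt; apply/negP => kj; move: f; rewrite /flow.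
    by rewrite /= !hr ?eqxx //; lia.
  case: ifPn => jn /=; first by rewrite !hr ?eqxx //; lia.
  have jE : j = n by lia.
  case: ifPn => n1 /=.
    by rewrite !hr ?eqxx //; lia.
  by rewrite !hr ?eqxx //; lia.
have A1V : A1 \subset (truncation G k).1.
  apply/fintype.subsetP => v vA; rewrite finset.in_set; apply/negP => /andP[sv].
  by rewrite (lab_line LG) ltr_nat ltnNge A1k.
exists A; last by move=> e; rewrite finset.in_set.
rewrite finset.in_set; apply/and4P; split => //.
  apply/fintype.subsetP => e eA; rewrite finset.in_set.
  by have [/(fintype.subsetP A1V) -> /(fintype.subsetP A1V) ->] := multipath_edge mA eA.
rewrite nsourcesE //; apply/eqP.
have -> : r = H n 0%N by rewrite hr //; lia.
suff h m : (m <= n)%N -> (\sum_(0 <= a < m) used A (Hor (Src a.+1)))%N = H m 0%N.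
  exact: h.
elim: m => [|m IHm] mn; first by rewrite big_geq.
rewrite big_nat_recr //= IHm; last lia.
by have := flowE (c := Hor (Src m.+1)) hH; rewrite usedE //=; lia.
Qed.

End Multipaths.

(** * The map L *)

Section RealWeights.
Variables (R : realType) (n : nat) (G : planarNetwork R).
Variables (lab : G -> vlabel) (code : edge G -> elabel).
Hypothesis LG : labelling n lab code.
Implicit Types (w : edge G -> R) (H : nat -> nat -> nat) (k r i : nat).

Definition height_weight w H : R := \sum_(e : edge G) w e * (flow H (code e))%:R.

Lemma weight_height (A : pregraph G) w H : (forall e, (e \in A.2) = flow H (code e) :> nat) ->
  weight A (fun e => of_real (w e)) = (height_weight w H)%:E.
Proof.
move=> AH; rewrite /weight /= sumEFin /height_weight big_mkcond /=.
congr (_%:E); apply: eq_bigr => e _; rewrite -AH.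
by case: (e \in A.2); rewrite ?mulr1 ?mulr0.
Qed.

Lemma height_weight0 k w H : (k <= n)%N -> height n k 0 H -> height_weight w H = 0.
Proof.
move=> kn hH; apply: big1 => e _.
have v := code_valid LG e; have := upper_le kn hH v; have := flowE hH v.
by case: flow => [|f]; rewrite ?mulr0 //; lia.
Qed.

Lemma height_weight_le_lfun k r w H : (k <= n)%N -> height n k r H ->
  ((height_weight w H)%:E <= lfun (truncation G k) r (fun e => of_real (w e)))%E.
Proof.
move=> kn; case: r => [|r] hH /=; first by rewrite (height_weight0 w kn hH).
have [A pA /weight_height <-] := height_multipath LG kn hH.
exact: le_bigmax_cond.
Qed.

(** The standard multipath shows that r-paths exist, so the maximum is attained and real; r = 0
    agrees with the convention l_0 = 0. *)
Lemma lfun_height k r w : (r <= k <= n)%N -> exists2 H, height n k r H &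
  lfun (truncation G k) r (fun e => of_real (w e)) = (height_weight w H)%:E.
Proof.
move=> rkn; have hS := standard_heightP rkn; have [_ kn] := andP rkn.
case: r rkn hS => [|r] rkn hS /=.
  by exists (standard_height k 0); rewrite // (height_weight0 w kn hS).
have [A pA _] := height_multipath LG kn hS.
rewrite (@bigmax_eq_arg _ _ _ _ A) //; last by move=> *; exact: leNye.
case: arg_maxP => // B pB _.
have [H hH BH] := multipath_height LG kn pB.
by exists H => //; exact: weight_height.
Qed.

Lemma height_weight_split w k p k' q Ha Hb :
  height n k p Ha -> height n k' q Hb ->
  let H j i := (Ha j i + Hb j i)%N in
  forall s s' m m', height n s m (fun j i => uphalf (H j i)) ->
    height n s' m' (fun j i => (H j i)./2) ->
  height_weight w (fun j i => uphalf (H j i)) +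
  height_weight w (fun j i => (H j i)./2) =
  height_weight w Ha + height_weight w Hb.
Proof.
move=> hA hB /= s s' m m' h1 h2; rewrite -!big_split; apply: eq_bigr => e _ /=.
have v := code_valid LG e; rewrite -!mulrDr -!natrD; congr (_ * _%:R).
have /= := flow_split (Ha := Ha) (Hb := Hb) (c := code e).
have := flowE hA v; have := flowE hB v; have := flowE h1 v; have := flowE h2 v.
by move=> -> -> -> ->; lia.
Qed.

(** Optimal heights for the smaller side are superposed; the two roundings compete on the larger
    side with the same total weight. *)
Lemma lfun_rhombus w k i : (0 < i <= k)%N -> (k < n)%N ->
  let l k i := fine (lfun (truncation G k) i (fun e => of_real (w e))) in
  l k.+1 i.-1 + l k i <= l k.+1 i + l k i.-1 /\
  l k.+1 i.+1 + l k i.-1 <= l k.+1 i + l k i.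
Proof.
move=> hi kn l.
have le_l s m H : (m <= s <= n)%N -> height n s m H -> height_weight w H <= l s m.
  move=> msn hH; have [_ sn] := andP msn.
  have := height_weight_le_lfun w sn hH; rewrite /l.
  by have [H' _ ->] := lfun_height w msn; rewrite lee_fin.
have ex_l s m : (m <= s <= n)%N -> exists2 H, height n s m H & l s m = height_weight w H.
  by move=> msn; have [H hH e] := lfun_height w msn; exists H; rewrite // /l e.
split.
  have [Ha hA ->] := ex_l k.+1 i.-1 ltac:(lia).
  have [Hb hB ->] := ex_l k i ltac:(lia).
  (* The odd total 2i - 1 splits into i paths for k + 1 and i - 1 for k. *)
  have := height_split kn hA hB; rewrite /= ifT; last lia.
  move=> [h1 h2]; rewrite -(height_weight_split w hA hB h1 h2).
  apply: lerD; apply: le_l; try lia.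
    by move: h1; congr (height n _ _ _); lia.
  by move: h2; congr (height n _ _ _); lia.
have [Ha hA ->] := ex_l k.+1 i.+1 ltac:(lia).
have [Hb hB ->] := ex_l k i.-1 ltac:(lia).
(* The even total 2i splits into i paths for each. *)
have := height_split kn hA hB; rewrite (_ : i.+1 + i.-1 = i.*2)%N ?odd_double /=; last lia.
move=> [h2 h1]; rewrite -(height_weight_split w hA hB h1 h2) addrC.
apply: lerD; apply: le_l; try lia.
  by move: h2; congr (height n _ _ _); lia.
by move: h1; congr (height n _ _ _); lia.
Qed.

Lemma height_weight_label (F : elabel -> R) H :
  height_weight (fun e => F (code e)) H = \sum_(c <- elabels n) F c * (flow H c)%:R.
Proof.
rewrite /height_weight -(big_map code xpredT (fun c => F c * (flow H c)%:R)).
apply: perm_big; apply: uniq_perm; last 1 first.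
- move=> c; rewrite mem_elabels; apply/mapP/idP => [[e _ ->]|/(code_surj LG)[e <-]].
    exact: (code_valid LG).
  by exists e; rewrite // mem_index_enum.
- by rewrite (map_inj_uniq (code_inj LG)) index_enum_uniq.
- exact: elabels_uniq.
Qed.

(** [label_weight_le] bounds every height function, and the standard one attains the bound. *)
Lemma lfun_pattern a k r : (r <= k <= n)%N -> interlacing n a ->
  lfun (truncation G k) r (fun e => of_real (pattern_weight a (code e))) =
  (\sum_(0 <= i < r) a k i)%:E.
Proof.
move=> rkn ia; have [_ kn] := andP rkn; apply/eqP; rewrite eq_le.
apply/andP; split; last first.
  rewrite -(label_weight_standard a rkn) -height_weight_label.
  exact: (height_weight_le_lfun _ kn (standard_heightP rkn)).
have [H hH ->] := lfun_height (fun e => pattern_weight a (code e)) rkn.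
by rewrite height_weight_label lee_fin; exact: label_weight_le hH.
Qed.

End RealWeights.

Lemma val_vt n k i : (i <= k <= n)%N -> \val (vt n k i) = (inord k, inord i).
Proof.
move=> h; rewrite /vt val_insubd /= !inordK; [|lia|lia].
by have [-> _] := andP h.
Qed.

Lemma vtE n (p : VT n) : p = vt n (\val p).1 (\val p).2.
Proof.
apply: val_inj; rewrite val_vt ?inord_val; first by case: (\val p).
by rewrite (valP p) /= -ltnS ltn_ord.
Qed.

Lemma LmapE (R : realType) (G : planarNetwork R) n eps k i : (i <= k <= n)%N ->
  \val (@Lmap R G n eps (vt n k i)) = lfun (truncation G k) i eps.
Proof. by move=> h; rewrite /= val_vt //= !inordK //; lia. Qed.

(** * Reaching the points of the closure by compactness *)

Section ShiftedLmap.
Variables (R : realType) (n : nat) (G : planarNetwork R).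

(* The points of C_2 approximating t satisfy t^k_0 = 0 only in the limit; the extra
   parameters z (inr k) account for t^k_0. *)
Definition shifted_Lmap (z : {ptws (edge G + 'I_n.+1)%type -> trop R}) :
    {ptws VT n -> trop R} := fun p =>
  exist (fun x => x \in trop R) _
    (trop_add (valP (@Lmap R G n (fun e => z (inl e)) p)) (valP (z (inr (\val p).1)))).

Lemma shifted_Lmap_continuous : continuous shifted_Lmap.
Proof.
apply: trop_ptws_continuous => p /=; apply: trop_add_continuous.
- by move=> z; exact: lfun_trop.
- by move=> z; exact: valP.
- move=> z; apply: (@continuous_comp _ _ _
    (fun z : {ptws (edge G + 'I_n.+1)%type -> trop R} =>
       (fun e => z (inl e)) : {ptws edge G -> trop R})
    (lfun (truncation G (\val p).1) (\val p).2)).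
    apply: trop_ptws_continuous => e; exact: trop_proj_continuous.
  exact: lfun_continuous.
- exact: trop_proj_continuous.
Qed.

Variables (lab : G -> vlabel) (code : edge G -> elabel).
Hypothesis LG : labelling n lab code.

Lemma C2_shifted_Lmap (M : R) (t : VT n -> R) : C2 t -> 0 <= M ->
  t (vt n n 1) - t (vt n n 0) <= M -> (forall k, (k <= n)%N -> t (vt n k 0) <= M) ->
  exists2 z, (forall i, (\val (z i) <= M%:E)%E) &
    shifted_Lmap z = (fun p => of_real (t p)).
Proof.
move=> tC M0 tM tM0.
pose a j i := t (vt n j i.+1) - t (vt n j i).
have ia : interlacing n a.
  by move=> j i ij jn; have [/= h1 h2] := tC j i.+1 isT ij jn; rewrite /a; lra.
(* Interlacing makes lambda^j_1 nondecreasing in j, so the bound on lambda^n_1 covers all source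
   edges. *)
have a0M d : (d < n)%N -> a (n - d)%N 0%N <= M.
  elim: d => [|d IHd] dn; first by rewrite subn0.
  apply: le_trans (IHd ltac:(lia)).
  have [+ _] := ia (n - d.+1)%N 0%N ltac:(lia) ltac:(lia).
  by rewrite (_ : (n - d.+1).+1 = n - d)%N //; lia.
exists (fun i : edge G + 'I_n.+1 => match i with
  | inl e => of_real (pattern_weight a (code e))
  | inr k => of_real (t (vt n k 0)) end).
  case=> [e|k] /=; rewrite lee_fin; last by apply: tM0; rewrite -ltnS.
  have := code_valid LG e; case: (code e) => [[j|j|j i|j i]|j i] //=; rewrite ?/slot => v.
    by have := a0M (n - j)%N ltac:(lia); rewrite subKn; last lia.
  have [_] := ia j i.-1 ltac:(lia) ltac:(lia); rewrite prednK; last lia.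
  lra.
apply/funext => p; rewrite (vtE p); have kn : ((\val p).1 <= n)%N by rewrite -ltnS ltn_ord.
have ik : ((\val p).2 <= (\val p).1)%N := valP p.
move: ik kn; move: (nat_of_ord _) (nat_of_ord _) => i k ik kn; apply: val_inj => /=.
rewrite val_vt ?ik //= !inordK; [|lia|lia].
rewrite (lfun_pattern LG) ?ik // -EFinD telescope_sumr // subrK.
by [].

Qed.

Lemma sub_closure_shifted (t : {ptws VT n -> trop R}) :
  closure (@C2_trop R n) t -> (forall k, (k <= n)%N -> \val (t (vt n k 0)) = 0%E) ->
  exists z, shifted_Lmap z = t.
Proof.
move=> clt t0.
(* For n = 0 the element [vt n n 1] defaults to (0, 0), and the argument still applies. *)
have [M1 tM1] : exists M1 : R, (\val (t (vt n n 1)) < M1%:E)%E.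
  case: (t (vt n n 1)) => [[r||] h] /=.
  - by exists (r + 1); rewrite lte_fin ltrDl.
  - by move: h; rewrite inE.
  - by exists 0; exact: ltNyr.
(* Near t one has t^n_1 < M1, t^n_0 > -1 and t^k_0 < 1, so [M] bounds both lambda^n_1 and the
   shifts. *)
pose M := Num.max 1 (M1 + 1).
pose K := [set z : {ptws (edge G + 'I_n.+1)%type -> trop R} |
  forall i, (\val (z i) <= M%:E)%E].
(* The image of a compact set is compact, hence closed in a Hausdorff space. *)
have KC : closed (shifted_Lmap @` K).
  apply: compact_closed.
    by apply: hausdorff_product => _; exact: trop_hausdorff.
  apply: continuous_compact; last exact: bounded_trop_compact.
  by apply: continuous_subspaceT; exact: shifted_Lmap_continuous.
have near_lt p (r : R) : (\val (t p) < r%:E)%E ->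
    \forall s \near t, (\val (s p) < r%:E)%E.
  move=> tr; apply: (@trop_proj_continuous R (VT n) p t [set x | (x < r%:E)%E]).
  by apply: open_nbhs_nbhs; split => //; exact: open_ereal_lt_ereal.
have near_gt p (r : R) : (r%:E < \val (t p))%E ->
    \forall s \near t, (r%:E < \val (s p))%E.
  move=> tr; apply: (@trop_proj_continuous R (VT n) p t [set x | (r%:E < x)%E]).
  by apply: open_nbhs_nbhs; split => //; exact: open_ereal_gt_ereal.
suff [z _ ze] : (shifted_Lmap @` K) t by exists z.
rewrite (proj1 (closure_id _) KC) => B nB.
have nU : \forall s \near t, [/\ B s, (\val (s (vt n n 1)) < M1%:E)%E,
    ((-1)%:E < \val (s (vt n n 0)))%E &
    forall k : 'I_n.+1, (\val (s (vt n k 0)) < 1%:E)%E].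
  have n1 := near_lt _ _ tM1.
  have n2 := near_gt (vt n n 0) (-1) ltac:(rewrite t0 // lte_fin; lra).
  have n3 : \forall s \near t, forall k : 'I_n.+1, (\val (s (vt n k 0)) < 1%:E)%E.
    have h (k : 'I_n.+1) : \forall s \near t, (\val (s (vt n k 0)) < 1%:E)%E.
      by apply: near_lt; rewrite t0 ?lte_fin // -ltnS.
    exact: (@filter_forall _ _ _ (nbhs t) _ h).
  by near=> s; split; near: s.
have [s [[u uC us] [Bs s1 s0 sk]]] := clt _ nU.
exists s; split => //; rewrite -us; move: s1 s0 sk; rewrite -us /= !lte_fin => s1 s0 sk.
have [||k kn|z zK zE] := C2_shifted_Lmap (M := M) uC.
- by rewrite le_max ler01.
- by rewrite le_max; apply/orP; right; lra.
- rewrite le_max ltW //; have := sk (inord k).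
  by rewrite inordK // lte_fin.
by exists z.
Unshelve. all: by end_near. Qed.

End ShiftedLmap.

Theorem theorem4p3 (R : realType) (n : nat) (G : planarNetwork R) :
  is_Gamma0 n G ->
  range (@Lmap R G n) =
    closure (@C2_trop R n) `&`
    [set t : {ptws VT n -> trop R} |
       forall k : nat, (k <= n)%N -> \val (t (vt n k 0)) = 0%E].
Proof.
move=> [xt [xh layout]]; have [lab [code LG]] := layout_labelling layout.
apply/seteqP; split => [_ [eps _ <-]|t [clt t0]].
  split; last by move=> k kn; rewrite LmapE.
  (* Real weights are dense and L is continuous, so it suffices to place the images of real weights
     in C_2. *)
  have : closure (@Lmap R G n @` range (fun (w : edge G -> R) =>
      (fun e => of_real (w e)) : {ptws edge G -> trop R})) (@Lmap R G n eps).
    apply: (closure_image (@Lmap_continuous R G n)); exists eps => //.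
    exact: closure_ptws_real.
  apply: closure_subset => _ [_ [w _ <-] <-].
  pose l k i := fine (lfun (truncation G k) i (fun e => of_real (w e))).
  exists (fun p : VT n => l (\val p).1 (\val p).2).
    move=> k i i0 ik kn; rewrite !val_vt /= ?inordK; try lia.
    by have [] := lfun_rhombus LG w (k := k) (i := i) ltac:(lia) kn.
  apply/funext => p; apply: val_inj => /=; rewrite /l.
  have [|H _ ->] := lfun_height LG w (k := (\val p).1) (r := (\val p).2); last by [].
  by rewrite (valP p) /= -ltnS ltn_ord.
have [z zt] := sub_closure_shifted LG clt t0.
(* Since t^k_0 = 0 is l_0 = 0 plus the shift, all shifts vanish and the edge weights alone give
   t. *)
exists (fun e => z (inl e)) => //; apply/funext => p; rewrite -zt.
apply: val_inj => /=; rewrite -[LHS]adde0; congr (_ + _)%E.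
have kn : ((\val p).1 <= n)%N by rewrite -ltnS ltn_ord.
have := t0 _ kn; rewrite -zt /= val_vt ?kn //= !inordK //.
by rewrite add0e inord_val => ->.
Qed.
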